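(* Let $\mathbb G$ be a compact quantum group and let $\widetilde{\mathbb G}$ denote the compact group of nonzero multiplicative linear functionals on the Fourier algebra $A(\mathbb G)$. Then the topological group $\widetilde{\mathbb G}_{\mathbb C}={\rm Spec}\,{\rm Pol}(\mathbb G)$ is isomorphic, as a topological group, to the abstract complexification $(\widetilde{\mathbb G})_{\mathbb C}={\rm Spec}\,{\rm Pol}(\widetilde{\mathbb G})$ of the compact group $\widetilde{\mathbb G}$.
   Context: A compact quantum group $\mathbb G$ has a dense Hopf $*$-algebra ${\rm Pol}(\mathbb G)$ with coproduct $\Delta$, spanned by the matrix coefficients $u^{(s)}_{ij}$ of a fixed complete family $(u^{(s)})_{s\in{\rm Irr}(\mathbb G)}$ of pairwise inequivalent irreducible unitary representations, $u^{(s)}\in M_{n_s}({\rm Pol}(\mathbb G))$. For a compact quantum group (in particular a compact group $K$, where ${\rm Pol}(K)$ is the algebra of matrix coefficients of finite-dimensional continuous representations), ${\rm Spec}\,{\rm Pol}$ denotes the set of nonzero algebra homomorphisms $\varphi:{\rm Pol}\to\mathbb C$; it is a group under convolution $\varphi*\psi=(\varphi\otimes\psi)\circ\Delta$, equivalently under componentwise matrix multiplication of $X_\varphi=((\mathrm{id}\otimes\varphi)(u^{(s)}))_s\in\prod_sM_{n_s}$, topologized by the product topology on $\prod_s M_{n_s}$ (pointwise convergence). For a compact group $K$, ${\rm Spec}\,{\rm Pol}(K)$ is called the abstract complexification $K_{\mathbb C}$ (McKennon). The Fourier algebra $A(\mathbb G)$ is the completion of ${\rm Pol}(\mathbb G)$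 for the norm $\|a\|=\sum_s\|A_s\|_{S^1_{n_s}}$ where $a=\sum_s\sum_{i,j}(A_s)_{ij}u^{(s)}_{ij}$, with the multiplication extending that of ${\rm Pol}(\mathbb G)$; its dual is $VN(\mathbb G)=\ell^\infty\text{-}\bigoplus_sM_{n_s}$. Its Gelfand spectrum $\widetilde{\mathbb G}$ is identified (by restriction) with the characters $\varphi$ of ${\rm Pol}(\mathbb G)$ with $X_\varphi\in VN(\mathbb G)$, with the group structure above and the weak$^*$ topology of $VN(\mathbb G)$; it is a compact group. *)

(* Defs.v *)
From HB Require Import structures.
From mathcomp Require Import all_boot all_order all_algebra.
From mathcomp Require Import all_classical all_reals.
From mathcomp Require Import complex.
Set Implicit Arguments. Unset Strict Implicit. Unset Printing Implicit Defensive.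
Import Order.TTheory GRing.Theory Num.Theory.
Local Open Scope ring_scope.
Local Open Scope classical_set_scope.
Local Open Scope complex_scope.

Section CQG.
Variables (R : realType).
Local Notation C := R[i].

(* continuity, on a subset S, of a map between function spaces D -> C and
   E -> C, both carrying the topology of pointwise convergence (product
   topology); written out through basic neighbourhoods *)
Definition ptws_cont_on (D E : Type) (S : set (D -> C)) (F : (D -> C) -> (E -> C)) :=
  forall x0, S x0 -> forall (N : nat) (es : 'I_N -> E) (eps : R), 0 < eps ->
    exists (M : nat) (ds : 'I_M -> D) (delta : R), 0 < delta /\
      forall x, S x -> (forall k, `|x (ds k) - x0 (ds k)| < delta%:C) ->
        forall k, `|F x (es k) - F x0 (es k)| < eps%:C.

Definition opnorm_le m (X : 'M[C]_m) (M : R) :=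
  forall v w : 'cV[C]_m,
    `|\sum_(i < m) \sum_(j < m) (w i 0)^* * X i j * v j 0| ^+ 2 <=
    (M%:C) ^+ 2 * (\sum_(i < m) `|v i 0| ^+ 2) * (\sum_(j < m) `|w j 0| ^+ 2).

Definition epair m (Om X : 'M[C]_m) : C := \sum_(i < m) \sum_(j < m) Om i j * X i j.

Variables (A : algType C) (Irr : eqType) (n : Irr -> nat).
Variable (u : forall s, 'M[A]_(n s)).

Definition lin_fun (f : A -> C) :=
  forall (c : C) (a b : A), f (c *: a + b) = c * f a + f b.

(* h = f * g (convolution (f (x) g) o Delta), Delta(u_ij) = sum_k u_ik (x) u_kj *)
Definition is_conv (f g h : A -> C) :=
  forall s (i j : 'I_(n s)), h (u s i j) = \sum_(k < n s) f (u s i k) * g (u s k j).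

Definition idx := {s : Irr & ('I_(n s) * 'I_(n s))%type}.
Definition ub (t : idx) : A := u (tag t) (tagged t).1 (tagged t).2.

Definition star_mx (star : A -> A) m (M : 'M[A]_m) : 'M[A]_m :=
  \matrix_(i, j) star (M j i).

(* Pol(G) of a compact quantum group G, presented as a CQG Hopf *-algebra A
   together with a complete family (u^(s)) of pairwise inequivalent irreducible
   unitary corepresentations: the coefficients u^(s)_ij form a linear basis of A
   (which encodes irreducibility, inequivalence and completeness), and the
   coproduct Delta(u^(s)_ij) = sum_k u^(s)_ik (x) u^(s)_kj is a unital
   *-homomorphism (tested against all pairs of linear functionals, which
   separate A (x) A), the counit is multiplicative. *)
Record cqg_algebra (star : A -> A) : Prop := {
  star_antilin : forall (c : C) (a b : A), star (c *: a + b) = c^* *: star a + star b;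
  star_antimul : forall a b, star (a * b) = star b * star a;
  star_invol : forall a, star (star a) = a;
  basis_span : forall a : A, exists (l : seq idx) (c : idx -> C),
      a = \sum_(t <- l) c t *: ub t;
  basis_free : forall (l : seq idx) (c : idx -> C), uniq l ->
      \sum_(t <- l) c t *: ub t = 0 -> forall t, t \in l -> c t = 0;
  u_unitary : forall s, u s *m star_mx star (u s) = 1%:M /\
                        star_mx star (u s) *m u s = 1%:M;
  coprod_mul : forall f g h, lin_fun f -> lin_fun g -> lin_fun h -> is_conv f g h ->
      forall s t (i j : 'I_(n s)) (k l : 'I_(n t)),
        h (u s i j * u t k l) =
        \sum_(p < n s) \sum_(q < n t) f (u s i p * u t k q) * g (u s p j * u t q l);
  coprod_unit : forall f g h, lin_fun f -> lin_fun g -> lin_fun h -> is_conv f g h ->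
      h 1 = f 1 * g 1;
  coprod_star : forall f g h, lin_fun f -> lin_fun g -> lin_fun h -> is_conv f g h ->
      forall s (i j : 'I_(n s)),
        h (star (u s i j)) = \sum_(k < n s) f (star (u s i k)) * g (star (u s k j));
  counit_mul : forall e, lin_fun e -> (forall s (i j : 'I_(n s)), e (u s i j) = (i == j)%:R) ->
      e 1 = 1 /\ forall a b, e (a * b) = e a * e b
}.

Definition is_char (phi : A -> C) :=
  [/\ lin_fun phi, forall a b, phi (a * b) = phi a * phi b & exists a, phi a != 0].
Definition SpecPol : set (A -> C) := [set phi | is_char phi].

Definition Xphi (phi : A -> C) s : 'M[C]_(n s) := \matrix_(i, j) phi (u s i j).

(* X_phi in VN(G) = l^oo-direct sum of the M_{n_s} *)
Definition in_VN (phi : A -> C) := exists M : R, forall s, opnorm_le (Xphi phi s) M.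

(* Gtilde = Gelfand spectrum of A(G), identified with these characters *)
Definition Gtilde : Type := {phi : A -> C | is_char phi /\ in_VN phi}.

(* elements of the predual A(G) = l^1-direct sum of the S^1_{n_s}:
   families Om with sum_s ||Om_s||_{S^1} < oo
   (||Om||_{S^1} = sup_{||X||<=1} |sum_ij Om_ij X_ij|) *)
Definition in_predual (Om : forall s, 'M[C]_(n s)) :=
  exists r : Irr -> R,
    (forall s (X : 'M[C]_(n s)), opnorm_le X 1 -> `|epair (Om s) X| <= (r s)%:C) /\
    exists B : R, forall l : seq Irr, uniq l -> \sum_(s <- l) r s <= B.

Definition has_sum (g : Irr -> C) (v : C) :=
  forall eps : R, 0 < eps -> exists l0 : seq Irr,
    forall l : seq Irr, uniq l -> {subset l0 <= l} ->
      `|\sum_(s <- l) g s - v| < eps%:C.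

(* continuity of h : Gtilde -> C for the weak* topology sigma(VN(G), A(G)) *)
Definition wstar_cont (h : Gtilde -> C) :=
  forall (x0 : Gtilde) (eps : R), 0 < eps ->
    exists (N : nat) (Oms : 'I_N -> forall s, 'M[C]_(n s)) (delta : R),
      [/\ 0 < delta, forall k, in_predual (Oms k) &
        forall x : Gtilde,
          (forall k, exists v, has_sum (fun s =>
               epair (Oms k s) (Xphi (sval x) s - Xphi (sval x0) s)) v
               /\ `|v| < delta%:C) ->
          `|h x - h x0| < eps%:C].

(* finite-dimensional continuous representations of the compact group Gtilde
   (group law = convolution, unit = counit) *)
Definition cont_rep m (pi : Gtilde -> 'M[C]_m) :=
  [/\ forall x y z : Gtilde, is_conv (sval x) (sval y) (sval z) -> pi z = pi x *m pi y,
      forall e : Gtilde, (forall s (i j : 'I_(n s)), sval e (u s i j) = (i == j)%:R) ->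
        pi e = 1%:M
    & forall i j, wstar_cont (fun x => pi x i j)].

Definition PolGt : set (Gtilde -> C) :=
  [set f | exists (N : nat) (ms : 'I_N -> nat)
             (pis : forall k, Gtilde -> 'M[C]_(ms k)) (cs : forall k, 'M[C]_(ms k)),
             (forall k, cont_rep (pis k)) /\
             f = fun x => \sum_(k < N) epair (cs k) (pis k x)].

(* Spec Pol(Gtilde): nonzero algebra homomorphisms Pol(Gtilde) -> C, each
   represented by its unique extension by 0 outside Pol(Gtilde) *)
Definition is_charGt (chi : (Gtilde -> C) -> C) :=
  [/\ forall (c : C) f g, PolGt f -> PolGt g ->
        chi (fun x => c * f x + g x) = c * chi f + chi g,
      forall f g, PolGt f -> PolGt g -> chi (fun x => f x * g x) = chi f * chi g,
      exists f, PolGt f /\ chi f != 0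
    & forall f, ~ PolGt f -> chi f = 0].
Definition SpecPolGt : set ((Gtilde -> C) -> C) := [set chi | is_charGt chi].

(* convolution on Spec Pol(Gtilde): (chi1 (x) chi2) o Delta, Delta f (x, y) = f (x y),
   i.e. matrix multiplication on every f.d. continuous representation *)
Definition is_convGt (chi1 chi2 chi3 : (Gtilde -> C) -> C) :=
  forall m (pi : Gtilde -> 'M[C]_m), cont_rep pi -> forall i j : 'I_m,
    chi3 (fun x => pi x i j) =
    \sum_(k < m) chi1 (fun x => pi x i k) * chi2 (fun x => pi x k j).

End CQG.

Arguments SpecPolGt {R A Irr n} u.
Arguments is_convGt {R A Irr n} u.
Arguments is_charGt {R A Irr n} u.
Arguments SpecPol {R} A.

(* Main.v *)
Require Import Defs.
From HB Require Import structures.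
From mathcomp Require Import all_boot all_order all_algebra.
From mathcomp Require Import all_classical all_reals.
From mathcomp Require Import complex sequences exp trigo.
From mathcomp Require Import ring lra.
Import Order.TTheory GRing.Theory Num.Theory.
Import ComplexField.Normc.
Local Open Scope ring_scope.
Local Open Scope classical_set_scope.

(** A character of [Pol(G)] is a family [X = (X_s)] of matrices.  If [X] is
    uniformly bounded, then every [X_s] is unitary: right convolution by the
    character [X^*X] is an algebra automorphism of [Pol(G)], so powers of its
    eigenvalues are again eigenvalues (they occur in tensor powers), as are
    their inverses (they occur in conjugates), and boundedness leaves only [1].
    Hence [K = Gtilde] consists of the unitary characters.

    [K] is Zariski dense in [Spec Pol(G)]: for [th] multiplicative on the positive
    reals, [th(X^*X)] is again a character, so [X = U |X|] and all [U |X|^{it}]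
    lie in [K]; an element of [Pol(G)] vanishing at the latter vanishes at [X].
    Therefore characters of [Pol(G)] are characters of its image
    [{hat a | a in Pol(G)}] in the functions on [K], and it remains to see that
    this image is all of [Pol(K)].

    Let [pi] be a finite-dimensional continuous representation of [K].  Matrix
    coefficients are almost periodic, so they have a von Neumann mean, which
    replaces the Haar measure.  Choose [p = hat b] with values in [[0, 1]],
    [p 1 = 1] and [p] bounded away from [1] where [pi] is not close to the
    identity.  For large [N] the matrix [T = mean (p^N pi)] is invertible, and
    [pi g T = mean_x (p^N (g^-1 x) pi x)] has entries in the image by expanding
    the coproduct of [b^N]; so has [pi g = (pi g T) T^-1]. *)

Set Implicit Arguments. Unset Strict Implicit. Unset Printing Implicit Defensive.

(** * Means of almost periodic functions *)

Lemma bernoulli_ge (R : realType) (h : R) k : 0 <= h -> 1 + k%:R * h <= (1 + h) ^+ k.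
Proof.
move=> h0; elim: k => [|k IH]; first by rewrite expr0 mul0r addr0.
rewrite exprS -natr1.
have : 0 <= k%:R * h * h by rewrite !mulr_ge0.
have : (1 + h) * (1 + k%:R * h) <= (1 + h) * (1 + h) ^+ k.
  by rewrite ler_wpM2l // addr_ge0.
lra.
Qed.

Lemma geometric_small (R : realType) (q D e : R) :
  0 <= q < 1 -> 0 < e -> exists k, q ^+ k * D <= e.
Proof.
move=> /andP[q0 q1] e0; have [D0|D0] := lerP D 0.
  by exists 0%N; rewrite expr0 mul1r (le_trans D0) // ltW.
have [->|qn0] := eqVneq q 0; first by exists 1%N; rewrite expr1 mul0r ltW.
have qp : 0 < q by rewrite lt0r qn0.
have hp : 0 < q^-1 - 1 by rewrite subr_gt0 invf_gt1.
have := archi_boundP (divr_ge0 (divr_ge0 (ltW D0) (ltW e0)) (ltW hp)).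
set k := Num.bound _; rewrite ltr_pdivrMr // => Hk.
exists k; have := bernoulli_ge k (ltW hp).
rewrite [1 + (_ - 1)]addrC subrK exprVn => Hb.
have qk : 0 < q ^+ k by rewrite exprn_gt0.
rewrite mulrC -ler_pdivlMr // -ler_pdivrMl // mulrC.
by apply: le_trans Hb; apply: ltW; apply: lt_le_trans Hk _; rewrite lerDr.
Qed.

Record is_group (K : Type) (mul : K -> K -> K) (one : K) (inv : K -> K) : Prop := IsGroup {
  grp_mulA : forall x y z, mul x (mul y z) = mul (mul x y) z;
  grp_mul1 : forall x, mul one x = x;
  grp_mulr1 : forall x, mul x one = x;
  grp_mulV : forall x, mul (inv x) x = one;
  grp_mulrV : forall x, mul x (inv x) = one }.

Section FlatAverages.
Variables (R : realType) (K : Type).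
Variables (mul : K -> K -> K) (one : K) (inv : K -> K).
Hypothesis G : is_group mul one inv.
Let mulA := grp_mulA G.
Let mul1 := grp_mul1 G.
Let mulr1 := grp_mulr1 G.
Let mulrV := grp_mulrV G.
Local Notation "x ** y" := (mul x y) (at level 40, left associativity).

(** Total boundedness, in the sup norm, of the functions [(a, b) |-> f (a ** x ** b)] for [x] in
    [K]. It is stated by finite colourings because those of two functions combine by pairing. *)
Definition almost_periodic (f : K -> R) := forall e, 0 < e ->
  exists (k : nat) (cl : K -> 'I_k), forall x y, cl x = cl y ->
    forall a b, `|f (a ** x ** b) - f (a ** y ** b)| <= e.
Local Notation ap := almost_periodic.

Lemma ap_net f e : ap f -> 0 < e ->
  exists (k : nat) (r : 'I_k -> K), (0 < k)%N /\
    forall x, exists i, forall a b, `|f (a ** x ** b) - f (a ** r i ** b)| <= e.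
Proof.
move=> apf e0; have [k [cl Hcl]] := apf e e0.
have k0 : (0 < k)%N by apply: leq_ltn_trans (ltn_ord (cl one)).
have /choice[r Hr] : forall i, exists r, forall x, cl x = i -> cl r = i.
  move=> i; have [[x <-]|H] := pselect (exists x, cl x = i); first by exists x.
  (* Colours that do not occur get the default [one]. *)
  by exists one => x cx; case: H; exists x.
by exists k, r; split=> // x; exists (cl x) => a b; apply: Hcl; rewrite (Hr _ x).
Qed.

Lemma ap_bounded f : ap f -> exists2 B, 0 < B & forall x, `|f x| <= B.
Proof.
move=> apf; have [k [r [_ H]]] := ap_net apf ltr01.
exists (1 + \sum_i `|f (r i)|) => [|x]; first by rewrite ltr_wpDr // sumr_ge0.
have [i /(_ one one)] := H x; rewrite !mul1 !mulr1 => Hi.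
have : `|f (r i)| <= \sum_i `|f (r i)| by rewrite (bigD1 i) //= lerDl sumr_ge0.
have := ler_normD (f x - f (r i)) (f (r i)); rewrite subrK.
lra.
Qed.

Definition avg (I : finType) (r : I -> K) (f : K -> R) (a : K) :=
  (\sum_i f (a ** r i)) / #|I|%:R.

Lemma avg_avg (I J : finType) (r : I -> K) (s : J -> K) f a :
  avg (fun p : J * I => s p.1 ** r p.2) f a = avg s (avg r f) a.
Proof.
rewrite /avg card_prod natrM invfM -mulr_suml -[RHS]mulrA; congr (_ * _); last exact: mulrC.
rewrite -(pair_bigA _ (fun j i => f (a ** (s j ** r i)))) /=.
by apply: eq_bigr => j _; apply: eq_bigr => i _; rewrite mulA.
Qed.

Lemma avg_le (I : finType) (r : I -> K) f a h :
  (0 < #|I|)%N -> (forall i, f (a ** r i) <= h) -> avg r f a <= h.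
Proof.
move=> I0 H; rewrite /avg ler_pdivrMr ?ltr0n //.
by rewrite mulr_natr -sumr_const; apply: ler_sum.
Qed.

Lemma avg_ge (I : finType) (r : I -> K) f a h :
  (0 < #|I|)%N -> (forall i, h <= f (a ** r i)) -> h <= avg r f a.
Proof.
move=> I0 H; rewrite /avg ler_pdivlMr ?ltr0n //.
by rewrite mulr_natr -sumr_const; apply: ler_sum.
Qed.

Lemma avg_near (I : finType) (r : I -> K) f a c e :
  (0 < #|I|)%N -> (forall i, `|f (a ** r i) - c| <= e) -> `|avg r f a - c| <= e.
Proof.
move=> I0 H; rewrite ler_distl; apply/andP; split.
  by apply: avg_ge => // i; have := H i; rewrite ler_distl => /andP[].
by apply: avg_le => // i; have := H i; rewrite ler_distl => /andP[].
Qed.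

Lemma avgD (I : finType) (r : I -> K) f g a :
  avg r (fun x => f x + g x) a = avg r f a + avg r g a.
Proof. by rewrite /avg big_split mulrDl. Qed.

Lemma avgZ (I : finType) (r : I -> K) c f a :
  avg r (fun x => c * f x) a = c * avg r f a.
Proof. by rewrite /avg -mulr_sumr mulrA. Qed.

Lemma avg_dist (I : finType) (r : I -> K) f a b e :
  (0 < #|I|)%N -> (forall i, `|f (a ** r i) - f (b ** r i)| <= e) ->
  `|avg r f a - avg r f b| <= e.
Proof.
move=> I0 H; rewrite /avg -mulrBl -sumrB normrM normfV normr_nat.
rewrite ler_pdivrMr ?ltr0n // mulr_natr -sumr_const.
by apply: le_trans (ler_norm_sum _ _ _) _; apply: ler_sum.
Qed.

Definition flat_avg (f : K -> R) (c e : R) :=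
  exists (I : finType) (r : I -> K), (0 < #|I|)%N /\ forall a, `|avg r f a - c| <= e.

(* Von Neumann's contraction: if an average [g] of [f] dips below the middle of
   its range at some [c], averaging [g] over the translates [inv (r j) ** c] of
   an [e]-net [r] lowers its maximum by a fixed proportion of the oscillation. *)
Lemma flat_avg_exists f e : ap f -> 0 < e -> exists c, flat_avg f c e.
Proof.
move=> apf e0.
pose spread D := exists (I : finType) (r : I -> K) lo, (0 < #|I|)%N /\
  forall a, lo <= avg r f a <= lo + D.
have e4 : 0 < e / 4 by lra.
have [N [r [N0 Hr]]] := ap_net apf e4.
(* One of the [N] translates gains half the oscillation [D] and the others need not gain, so [D]
   shrinks by the factor [1 - 1 / (2 * N)], up to the net error [e / 4] divided by [N]. *)
pose q : R := 1 - (2 * N%:R)^-1.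
have Np : (1 : R) <= N%:R by rewrite ler1n.
have Nv : (N%:R : R) * N%:R^-1 = 1 by rewrite divff // gt_eqF ?ltr0n.
have Vp : 0 < (N%:R : R)^-1 by rewrite invr_gt0; lra.
have V1 : (N%:R : R)^-1 <= 1 by rewrite invf_le1 //; lra.
have qE : q = 1 - N%:R^-1 / 2 by rewrite /q invfM mulrC.
have step D : 0 <= D -> spread D -> spread (q * D + (e / 4) / N%:R).
  move=> D0 [I [s [lo [I0 Hs]]]].
  (* If no value lies below the middle, the lower bound moves up by [D / 2] without further
     averaging. *)
  have [[c Hc]|Hc] := pselect (exists c, avg s f c <= lo + D / 2); last first.
    exists I, s, (lo + D / 2); split=> // a; have /andP[Ha1 Ha2] := Hs a.
    apply/andP; split.
      by rewrite leNgt; apply/negP => /ltW H; apply: Hc; exists a.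
    apply: le_trans Ha2 _; rewrite qE.
    have : 0 <= D * (1 - N%:R^-1) by rewrite mulr_ge0 // subr_ge0.
    have : 0 <= e / 4 / N%:R by rewrite mulr_ge0 // ltW.
    lra.
  exists ('I_N * I)%type, (fun p => (inv (r p.1) ** c) ** s p.2), lo.
  split; first by rewrite card_prod card_ord muln_gt0 N0.
  move=> a; rewrite (avg_avg s (fun j => inv (r j) ** c)); apply/andP; split.
    by apply: avg_ge; rewrite ?card_ord // => j; case/andP: (Hs (a ** (inv (r j) ** c))).
  have [i Hi] := Hr a.
  rewrite /avg card_ord ler_pdivrMr ?ltr0n // (bigD1 i) //=.
  have near : avg s f (a ** (inv (r i) ** c)) <= lo + D / 2 + e / 4.
    have : `|avg s f (a ** (inv (r i) ** c)) - avg s f c| <= e / 4.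
      apply: avg_dist => // j; have := Hi one ((inv (r i) ** c) ** s j).
      by rewrite !mul1 !mulA mulrV mul1.
    rewrite ler_distl => /andP[_ H]; lra.
  have rest : \sum_(j < N | j != i) avg s f (a ** (inv (r j) ** c)) <= (N%:R - 1) * (lo + D).
    apply: le_trans (_ : \sum_(j < N | j != i) (lo + D) <= _).
      by apply: ler_sum => j _; case/andP: (Hs (a ** (inv (r j) ** c))).
    rewrite sumr_const cardC1 card_ord -[leLHS]mulr_natl.
    by rewrite -subn1 natrB.
  apply: le_trans (lerD near rest) _.
  have -> : (lo + (q * D + e / 4 / N%:R)) * N%:R
     = lo * N%:R + (N%:R * D - (N%:R * N%:R^-1) / 2 * D) + e / 4 * (N%:R * N%:R^-1).
    rewrite qE; ring.
  rewrite Nv; lra.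
have q01 : 0 <= q < 1 by rewrite qE; apply/andP; split; lra.
have [B B0 HB] := ap_bounded apf.
(* The offset [e / 2] is the fixed point of [D |-> q * D + (e / 4) / N]. *)
have iter k : spread (q ^+ k * (2 * B) + e / 2).
  elim: k => [|k IH].
    exists unit, (fun _ => one), (- B); split; first by rewrite card_unit.
    move=> a; rewrite /avg card_unit divr1 big_const card_unit /= addr0 mulr1 expr0 mul1r.
    have := HB a; rewrite ler_norml => /andP[H1 H2]; apply/andP; split; lra.
  have /andP[q0 _] := q01.
  have := step _ _ IH; rewrite exprS.
  have -> : q * q ^+ k * (2 * B) + e / 2 = q * (q ^+ k * (2 * B) + e / 2) + e / 4 / N%:R.
    rewrite qE; field; rewrite gt_eqF ?ltr0n //.
  by apply; rewrite addr_ge0 ?mulr_ge0 ?exprn_ge0 //; lra.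
have e2 : 0 < e / 2 by lra.
have [k Hk] := geometric_small (2 * B) q01 e2.
have [I [s [lo [I0 Hs]]]] := iter k.
exists (lo + e / 2), I, s; split=> // a; have /andP[H1 H2] := Hs a.
rewrite ler_distl; apply/andP; split; lra.
Qed.

End FlatAverages.

Lemma is_group_op (K : Type) (mul : K -> K -> K) one inv :
  is_group mul one inv -> is_group (fun x y => mul y x) one inv.
Proof. by case=> A l r iv vi; split. Qed.

Lemma almost_periodic_op (R : realType) (K : Type) (mul : K -> K -> K) one inv (f : K -> R) :
  is_group mul one inv -> almost_periodic mul f -> almost_periodic (fun x y => mul y x) f.
Proof.
move=> G apf e e0; have [k [cl H]] := apf e e0; exists k, cl => x y /H{}H a b.
by rewrite !(grp_mulA G).
Qed.

(** * The invariant mean of an almost periodic function *)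

Section Mean.
Variables (R : realType) (K : Type).
Variables (mul : K -> K -> K) (one : K) (inv : K -> K).
Hypothesis G : is_group mul one inv.
Let mulA := grp_mulA G.
Local Notation "x ** y" := (mul x y) (at level 40, left associativity).
Local Notation ap := (@almost_periodic R K mul).
Local Notation flat := (@flat_avg R K mul).
Local Notation lflat := (@flat_avg R K (fun x y => mul y x)).

(* Averaging [f (s j ** r i)] over both families compares left with right averages. *)
Lemma flat_lflat f c d e e' : flat f c e -> lflat f d e' -> `|c - d| <= e + e'.
Proof.
move=> [I [r [I0 Hr]]] [J [s [J0 Hs]]].
pose w := (\sum_j \sum_i f (s j ** r i)) / #|J|%:R / #|I|%:R.
have w1 : `|w - c| <= e.
  have -> : w = avg (fun x y => y) s (avg mul r f) one.
    by rewrite /avg /w -mulr_suml mulrAC.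
  by apply: avg_near.
have w2 : `|w - d| <= e'.
  have -> : w = avg (fun x y => y) r (avg (fun x y => mul y x) s f) one.
    by rewrite /avg /w -mulr_suml exchange_big.
  by apply: avg_near.
have -> : c - d = (w - d) - (w - c) by ring.
by apply: le_trans (ler_normB _ _) _; rewrite addrC lerD.
Qed.

Lemma lflat_exists f e : ap f -> 0 < e -> exists c, lflat f c e.
Proof. by move=> apf; exact: (flat_avg_exists (is_group_op G) (almost_periodic_op G apf)). Qed.

(** A supremum of uniform lower bounds, so that it makes sense for every [f]; for almost periodic
    [f] it is the only constant that right averages approximate uniformly ([mean_flat],
    [mean_uniq]). *)
Definition mean (f : K -> R) : R :=
  sup [set t | exists (I : finType) (r : I -> K), (0 < #|I|)%N /\ forall a, t <= avg mul r f a].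

(** A left average that is nearly the constant [d] bounds every uniform lower bound of right
    averages, hence the supremum, by about [d]; [flat_lflat] puts [d] near [c]. *)
Lemma flat_mean f c e : ap f -> flat f c e -> `|mean f - c| <= e.
Proof.
move=> apf fl; apply/ler_addgt0Pr => eta eta0.
have eta2 : 0 < eta / 2 by lra.
have [d Hd] := lflat_exists apf eta2.
have := flat_lflat fl Hd; rewrite ler_distl => /andP[cd1 cd2].
rewrite /mean; set S := [set t | _].
have ubS : ubound S (d + eta / 2).
  move=> t [I [r [I0 Ht]]]; case: Hd => J [s [J0 Hs]].
  have : t <= avg (fun x y => y) s (avg mul r f) one by apply: avg_ge.
  have : avg (fun x y => y) r (avg (fun x y => mul y x) s f) one <= d + eta / 2.
    by apply: avg_le => // i; have := Hs (r i); rewrite ler_distl => /andP[].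
  rewrite /avg -!mulr_suml exchange_big mulrAC; exact: (fun a b => le_trans b a).
have inS : S (c - e).
  case: fl => I [r [I0 Hr]]; exists I, r; split=> // a.
  by have := Hr a; rewrite ler_distl => /andP[].
have h1 : c - e <= sup S by apply: ub_le_sup => //; exists (d + eta / 2).
have h2 : sup S <= d + eta / 2 by apply: ge_sup => //; exists (c - e).
rewrite ler_distl; apply/andP; split; lra.
Qed.

Lemma mean_flat f e : ap f -> 0 < e -> flat f (mean f) e.
Proof.
move=> apf e0; have e2 : 0 < e / 2 by lra.
have [c Hc] := flat_avg_exists G apf e2.
have := flat_mean apf Hc; rewrite ler_distl => /andP[m1 m2].
case: Hc => I [r [I0 Hr]]; exists I, r; split=> // a.
have := Hr a; rewrite !ler_distl => /andP[h1 h2]; apply/andP; split; lra.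
Qed.

Lemma mean_uniq f c : ap f -> (forall e, 0 < e -> flat f c e) -> mean f = c.
Proof.
move=> apf H; apply/eqP; rewrite -subr_eq0 -normr_le0; apply/ler_addgt0Pr => e e0; rewrite add0r.
exact: flat_mean apf (H e e0).
Qed.

Lemma apD f g : ap f -> ap g -> ap (fun x => f x + g x).
Proof.
move=> apf apg e e0; have e2 : 0 < e / 2 by lra.
have [k [cl Hf]] := apf _ e2; have [l [dl Hg]] := apg _ e2.
exists #|{: 'I_k * 'I_l}|, (fun x => enum_rank (cl x, dl x)) => x y /enum_rank_inj[cE dE] a b.
rewrite opprD addrACA; apply: le_trans (ler_normD _ _) _.
have := Hf _ _ cE a b; have := Hg _ _ dE a b; lra.
Qed.

Lemma apM f g : ap f -> ap g -> ap (fun x => f x * g x).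
Proof.
move=> apf apg e e0.
have [B B0 HB] := ap_bounded G apf; have [D D0 HD] := ap_bounded G apg.
have eD : 0 < e / 2 / D by rewrite divr_gt0 //; lra.
have eB : 0 < e / 2 / B by rewrite divr_gt0 //; lra.
have [k [cl Hf]] := apf _ eD; have [l [dl Hg]] := apg _ eB.
exists #|{: 'I_k * 'I_l}|, (fun x => enum_rank (cl x, dl x)) => x y /enum_rank_inj[cE dE] a b.
have -> : f (a ** x ** b) * g (a ** x ** b) - f (a ** y ** b) * g (a ** y ** b) =
   (f (a ** x ** b) - f (a ** y ** b)) * g (a ** x ** b) +
   f (a ** y ** b) * (g (a ** x ** b) - g (a ** y ** b)) by ring.
apply: le_trans (ler_normD _ _) _; rewrite !normrM.
have H1 := ler_pM (normr_ge0 _) (normr_ge0 _) (Hf _ _ cE a b) (HD (a ** x ** b)).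
have H2 := ler_pM (normr_ge0 _) (normr_ge0 _) (HB (a ** y ** b)) (Hg _ _ dE a b).
apply: le_trans (lerD H1 H2) _.
by rewrite divfK ?gt_eqF // [B * _]mulrC divfK ?gt_eqF // -splitr.
Qed.

Lemma ap_cst c : ap (fun=> c).
Proof. by move=> e e0; exists 1%N, (fun=> ord0) => *; rewrite subrr normr0 ltW. Qed.

Lemma apZ c f : ap f -> ap (fun x => c * f x).
Proof. exact: apM (ap_cst c). Qed.

Lemma ap_sum (I : Type) (s : seq I) (F : I -> K -> R) :
  (forall i, ap (F i)) -> ap (fun x => \sum_(i <- s) F i x).
Proof.
move=> H; elim: s => [|i s IH].
  by apply: eq_rect (ap_cst 0) _ _; apply/funext => x; rewrite big_nil.
by apply: eq_rect (apD (H i) IH) _ _; apply/funext => x; rewrite big_cons.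
Qed.

Lemma ap_exp f k : ap f -> ap (fun x => f x ^+ k).
Proof.
move=> apf; elim: k => [|k IH]; first exact: ap_cst.
by apply: eq_rect (apM apf IH) _ _; apply/funext => x; rewrite exprS.
Qed.

Lemma ap_translate g f : ap f -> ap (fun x => f (g ** x)).
Proof.
move=> apf e e0; have [k [cl H]] := apf e e0; exists k, cl => x y /H{}H a b.
by rewrite !mulA.
Qed.

Lemma ap_avg (I : finType) (r : I -> K) f : ap f -> ap (avg mul r f).
Proof.
move=> apf e e0; have [k [cl H]] := apf e e0; exists k, cl => x y /H{}H a b.
(* For empty [I] the average is [0], since [0^-1 = 0]. *)
have [I0|I0] := posnP #|I|.
  by rewrite /avg I0 invr0 !mulr0 subrr normr0 ltW.
by apply: avg_dist => // i; rewrite -!(mulA _ b).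
Qed.

(** An average of an average of [f] is again an average of [f], over products of translates, so a
    flat one serves both functions. *)
Lemma mean_avg (I : finType) (r : I -> K) f : (0 < #|I|)%N -> ap f ->
  mean (avg mul r f) = mean f.
Proof.
move=> I0 apf; apply/esym/mean_uniq => // e e0.
have [J [s [J0 Hs]]] := mean_flat (ap_avg r apf) e0.
exists (J * I)%type, (fun p => s p.1 ** r p.2).
split; first by rewrite card_prod muln_gt0 J0.
by move=> a; rewrite (avg_avg G).
Qed.

(** [r] flattens [f], then [s] flattens the average of [g] over [r]. Averaging over [s] keeps [f]
    flat, so one product family serves both summands. *)
Lemma meanD f g : ap f -> ap g -> mean (fun x => f x + g x) = mean f + mean g.
Proof.
move=> apf apg; apply: mean_uniq (apD apf apg) _ => e e0; have e2 : 0 < e / 2 by lra.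
have [I [r [I0 Hr]]] := mean_flat apf e2.
have [J [s [J0 Hs]]] := mean_flat (ap_avg r apg) e2.
exists (J * I)%type, (fun p => s p.1 ** r p.2).
split; first by rewrite card_prod muln_gt0 J0.
move=> a; rewrite avgD !(avg_avg G) opprD addrACA; apply: le_trans (ler_normD _ _) _.
have := Hs a; rewrite (mean_avg r I0 apg).
have : `|avg mul s (avg mul r f) a - mean f| <= e / 2 by apply: avg_near.
lra.
Qed.

Lemma meanZ c f : ap f -> mean (fun x => c * f x) = c * mean f.
Proof.
move=> apf; apply: mean_uniq (apZ c apf) _ => e e0.
have c0 : 0 < `|c| + 1 by rewrite ltr_wpDl.
have [I [r [I0 Hr]]] := mean_flat apf (divr_gt0 e0 c0).
exists I, r; split=> // a; rewrite avgZ -mulrBr normrM.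
apply: le_trans (ler_wpM2l (normr_ge0 _) (Hr a)) _.
by rewrite mulrA ler_pdivrMr // mulrC ler_pM2l // lerDl.
Qed.

Lemma mean_cst c : mean (fun=> c) = c.
Proof.
apply: mean_uniq (ap_cst c) _ => e e0; exists unit, (fun=> one).
split; first by rewrite card_unit.
by move=> a; apply: avg_near; rewrite ?card_unit // => i; rewrite subrr normr0 ltW.
Qed.

Lemma mean_translate g f : ap f -> mean (fun x => f (g ** x)) = mean f.
Proof.
move=> apf; apply: mean_uniq (ap_translate g apf) _ => e e0.
have [I [r [I0 Hr]]] := mean_flat apf e0; exists I, r; split=> // a.
rewrite (_ : avg mul r (fun x => f (g ** x)) a = avg mul r f (g ** a)) //.
by congr (_ / _); apply: eq_bigr => i _; rewrite mulA.
Qed.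

Lemma mean_ge0 f : ap f -> (forall x, 0 <= f x) -> 0 <= mean f.
Proof.
move=> apf f0; apply/ler_addgt0Pr => e e0.
have [I [r [I0 Hr]]] := mean_flat apf e0.
have := Hr one; rewrite ler_distl => /andP[_]; apply: le_trans.
by apply: avg_ge.
Qed.

Lemma ap_sub f g : ap f -> ap g -> ap (fun x => f x - g x).
Proof.
move=> apf apg; apply: eq_rect (apD apf (apZ (-1) apg)) _ _.
by apply/funext => x; rewrite mulN1r.
Qed.

Lemma mean_le f g : ap f -> ap g -> (forall x, f x <= g x) -> mean f <= mean g.
Proof.
move=> apf apg fg; rewrite -subr_ge0 -mulN1r -meanZ // -meanD //; last exact: apZ.
apply: mean_ge0 => [|x]; first by apply: apD => //; apply: apZ.
by rewrite mulN1r subr_ge0.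
Qed.

Lemma mean_sum (I : Type) (s : seq I) (F : I -> K -> R) :
  (forall i, ap (F i)) -> mean (fun x => \sum_(i <- s) F i x) = \sum_(i <- s) mean (F i).
Proof.
move=> H; elim: s => [|i s IH].
  by rewrite big_nil -[RHS](mean_cst 0); congr mean; apply/funext => x; rewrite big_nil.
rewrite big_cons -IH -meanD //; last exact: ap_sum.
by congr mean; apply/funext => x; rewrite big_cons.
Qed.

End Mean.

(** * Functional calculus of positive matrices *)

Section FunctionalCalculus.
Local Open Scope complex_scope.
Local Open Scope sesquilinear_scope.
Variable C : numClosedFieldType.

Lemma adj_mulmx m p q (X : 'M[C]_(m, p)) (Y : 'M[C]_(p, q)) :
  (X *m Y)^t* = Y^t* *m X^t*.
Proof. by rewrite trmx_mul map_mxM. Qed.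

Lemma sqnormE m (v : 'cV[C]_m) : (v^t* *m v) 0 0 = \sum_i `|v i 0| ^+ 2.
Proof. by rewrite mxE; apply: eq_bigr => i _; rewrite !mxE mulrC -normCK. Qed.

Lemma sqnorm_gt0 m (v : 'cV[C]_m) : v != 0 -> 0 < (v^t* *m v) 0 0.
Proof.
move=> v0; rewrite sqnormE; have [i vi0] : exists i, v i 0 != 0.
  apply/existsP; apply: contraR v0; rewrite negb_exists => /forallP E.
  by apply/eqP/matrixP => i j; rewrite ord1 mxE; apply/eqP; rewrite -[_ == _]negbK E.
rewrite (bigD1 i) //=; apply: ltr_pwDl; first by rewrite exprn_gt0 // normr_gt0.
by apply: sumr_ge0 => j _; rewrite exprn_ge0.
Qed.

Variable m : nat.
Implicit Types (P X : 'M[C]_m) (th : C -> C).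

Definition fcalc th P : 'M[C]_m :=
  invmx (spectralmx P) *m diag_mx (map_mx th (spectral_diag P)) *m spectralmx P.

(** In the spectral basis [w] is supported on the coordinates whose diagonal entry is [nu], and
    there [th] contributes the factor [th nu]. *)
Lemma fcalc_eigen th P w nu : P \is normalmx -> P *m w = nu *: w ->
  fcalc th P *m w = th nu *: w :> 'cV_m.
Proof.
move=> /orthomx_spectralP E; have Vu := spectral_unit P.
rewrite /fcalc; set V := spectralmx P in E Vu *; set d := spectral_diag P in E *.
move=> Pw; have Dw : diag_mx d *m (V *m w) = nu *: (V *m w).
  by rewrite scalemxAr -Pw [in RHS]E !mulmxA mulmxV // mul1mx.
have -> : invmx V *m diag_mx (map_mx th d) *m V *m w
        = invmx V *m (diag_mx (map_mx th d) *m (V *m w)) by rewrite !mulmxA.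
have -> : diag_mx (map_mx th d) *m (V *m w) = th nu *: (V *m w).
  apply/matrixP => i j; have /matrixP/(_ i j) := Dw.
  rewrite !mul_diag_mx !mxE; set x := \sum_k _ => /eqP.
  rewrite -subr_eq0 -mulrBl mulf_eq0 subr_eq0 => /orP[/eqP->//|/eqP->].
  by rewrite !mulr0.
by rewrite -scalemxAr mulKmx.
Qed.

Lemma fcalcM th th' P : fcalc th P *m fcalc th' P = fcalc (fun x => th x * th' x) P.
Proof.
rewrite /fcalc !mulmxA mulmxK ?spectral_unit //; congr (_ *m _).
rewrite -!mulmxA mulmx_diag; congr (_ *m diag_mx _).
by apply/rowP => j; rewrite !mxE.
Qed.

Lemma fcalc_cst1 th P : (forall i, th (spectral_diag P 0 i) = 1) -> fcalc th P = 1%:M.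
Proof.
move=> E; rewrite /fcalc (_ : diag_mx _ = 1%:M) ?mulmx1 ?mulVmx ?spectral_unit //.
rewrite -diag_const_mx; congr diag_mx; apply/matrixP => i j.
by rewrite !mxE (ord1 i) E.
Qed.

Lemma fcalc_id P : P \is normalmx -> fcalc id P = P.
Proof. by move=> /orthomx_spectralP {2}->; rewrite /fcalc map_mx_id. Qed.

Lemma fcalc_adj th P : (fcalc th P)^t* = fcalc (fun x => (th x)^*%R) P.
Proof.
have Vu := spectral_unitarymx P.
rewrite /fcalc invmx_unitary // !adj_mulmx trmxCK mulmxA; congr (_ *m _ *m _).
by rewrite tr_diag_mx map_diag_mx -map_mx_comp.
Qed.

Lemma col_mulmx (X Y : 'M[C]_m) l : col l (X *m Y) = X *m col l Y.
Proof. by rewrite !colE mulmxA. Qed.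

Lemma spectral_col P l : P \is normalmx ->
  P *m col l (invmx (spectralmx P)) =
  spectral_diag P 0 l *: col l (invmx (spectralmx P)).
Proof.
move=> /orthomx_spectralP; have := spectral_unit P; rewrite -col_mulmx.
set V := spectralmx P; set d := spectral_diag P => Vu ->.
rewrite mulmxK //.
by apply/matrixP => i j; rewrite mul_mx_diag !mxE mulrC.
Qed.

Lemma spectral_row P l : P \is normalmx ->
  row l (spectralmx P) *m P = spectral_diag P 0 l *: row l (spectralmx P).
Proof.
move=> /orthomx_spectralP; have := spectral_unit P; rewrite -row_mul.
set V := spectralmx P; set d := spectral_diag P => Vu ->.
rewrite !mulmxA mulmxV // mul1mx.
by apply/matrixP => i j; rewrite mul_diag_mx !mxE.
Qed.

Lemma row_unit_neq0 X l : X \in unitmx -> row l X != 0.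
Proof.
move=> Xu; apply/negP => /eqP E; have := row_mul l X (invmx X).
rewrite mulmxV // E mul0mx => /matrixP/(_ 0 l) /eqP.
by rewrite !mxE eqxx oner_eq0.
Qed.

Lemma col_unit_neq0 X l : X \in unitmx -> col l X != 0.
Proof.
move=> Xu; apply/negP => /eqP E; have := col_mulmx (invmx X) X l.
rewrite mulVmx // E mulmx0 => /matrixP/(_ l 0) /eqP.
by rewrite !mxE eqxx oner_eq0.
Qed.

Lemma gram_adj X : (X^t* *m X)^t* = X^t* *m X.
Proof. by rewrite adj_mulmx trmxCK. Qed.

Lemma gram_normal X : X^t* *m X \is normalmx.
Proof. by apply/normalmxP; rewrite gram_adj. Qed.

(** For an eigenvector [v] with eigenvalue [d], [d |v|^2 = |X v|^2 > 0]. *)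
Lemma gram_spectral_gt0 X l : X \in unitmx -> 0 < spectral_diag (X^t* *m X) 0 l.
Proof.
move=> Xu; have := spectral_col l (gram_normal X).
set v := col l _; set d := spectral_diag _ _ _ => E.
have v0 : v != 0 by rewrite col_unit_neq0 // unitmx_inv spectral_unit.
have Xv0 : X *m v != 0 by apply: contra v0 => /eqP h; rewrite -(mulKmx Xu v) h mulmx0.
have := sqnorm_gt0 Xv0; rewrite adj_mulmx -mulmxA (mulmxA _ X) E -scalemxAr mxE.
by rewrite pmulr_lgt0 // sqnorm_gt0.
Qed.

Lemma unitarymx_adj X : X^t* *m X = 1%:M -> X \is unitarymx.
Proof. by move=> /mulmx1C E; apply/unitarymxP. Qed.

(** The Gram matrix of [X th(G)], where [G = X^*X], is the function [conj(th x) x th(x)] of [G],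
    which is [1] on the positive spectrum. *)
Lemma polar_unitarymx th X : X \in unitmx ->
  (forall x, 0 < x -> (th x)^*%R * (x * th x) = 1) ->
  X *m fcalc th (X^t* *m X) \is unitarymx.
Proof.
move=> Xu E; apply: unitarymx_adj; rewrite adj_mulmx -mulmxA (mulmxA _ X).
have := gram_normal X; have := fun l => gram_spectral_gt0 l Xu.
move: (X^t* *m X) => G G0 Gn; rewrite -{2}(fcalc_id Gn) fcalc_adj !fcalcM.
by apply: fcalc_cst1 => l; apply: E.
Qed.

End FunctionalCalculus.

(** Newton interpolation: the polynomial for the other nodes is corrected at [z] by a multiple of
    the product vanishing at those nodes. *)
Lemma poly_interpolation (F : fieldType) (zs : seq F) (g : F -> F) :
  exists p : {poly F}, forall z, z \in zs -> p.[z] = g z.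
Proof.
suff [p Hp] : exists p : {poly F}, forall z, z \in undup zs -> p.[z] = g z.
  by exists p => z zz; apply: Hp; rewrite mem_undup.
have := undup_uniq zs; elim: (undup zs) => [_|z l IH /= /andP[zl /IH[p Hp]]].
  by exists 0.
pose q : {poly F} := \prod_(y <- l) ('X - y%:P).
have qz : q.[z] != 0 by rewrite -/(root q z) root_prod_XsubC.
exists (p + ((g z - p.[z]) / q.[z]) *: q) => y; rewrite inE => /orP[/eqP->|yl].
  by rewrite hornerD hornerZ divfK // addrC subrK.
have /eqP qy : root q y by rewrite root_prod_XsubC.
by rewrite hornerD hornerZ qy mulr0 addr0 Hp.
Qed.

(** * Imaginary powers of positive numbers *)

Section UnitaryPowers.
Local Open Scope complex_scope.
Local Open Scope sesquilinear_scope.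
Variable R : realType.
Local Notation C := R[i].
Local Notation Re := (@complex.Re R).
Local Notation Im := (@complex.Im R).

(* $x^{it}$ for [0 < x] *)
Definition ipow (t : R) (x : C) : C := Complex (cos (t * ln (Re x))) (sin (t * ln (Re x))).

Lemma pos_complex (x : C) : 0 < x -> x = (Re x)%:C /\ 0 < Re x.
Proof. by case: x => a b; rewrite ltcE /= => /andP[/eqP-> ->]. Qed.

Lemma ipow1 t : ipow t 1 = 1.
Proof. by rewrite /ipow /= ln1 mulr0 cos0 sin0. Qed.

Lemma ipowM t x y : 0 < x -> 0 < y -> ipow t (x * y) = ipow t x * ipow t y.
Proof.
move=> /pos_complex[-> x0] /pos_complex[-> y0]; rewrite -rmorphM /ipow /= lnM ?posrE //.
by rewrite mulrDr cosD sinD; apply/eqP; rewrite eq_complex /= [X in _ && (X == _)]addrC !eqxx.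
Qed.

Lemma ipow_unit t x : (ipow t x)^*%R * ipow t x = 1.
Proof.
rewrite mulrC -normCK normc_def /= cos2Dsin2 sqrtr1 expr1n //.
Qed.

Lemma ipow_natmul t x k : ipow (k%:R * t) x = ipow t x ^+ k.
Proof.
elim: k => [|k IH]; first by rewrite /ipow !mul0r cos0 sin0 expr0.
rewrite exprS -IH -natr1 /ipow.
rewrite (_ : _ * ln _ = t * ln (Re x) + k%:R * t * ln (Re x)); last ring.
by rewrite cosD sinD; apply/eqP; rewrite eq_complex /= [X in _ && (X == _)]addrC !eqxx.
Qed.

(* For small [t], the map [x |-> x^{it}] is injective on the finitely many
   [nu p]; polynomial interpolation then replaces the functions [x^{ikt}] by
   an arbitrary function [th]. *)
Lemma ipow_separates (T : eqType) (l : seq T) (nu c : T -> C) (th : C -> C) :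
  (forall p, 0 < nu p) -> (forall t, \sum_(p <- l) ipow t (nu p) * c p = 0) ->
  \sum_(p <- l) th (nu p) * c p = 0.
Proof.
move=> nu0 E; pose B := 1 + \sum_(p <- l) `|ln (Re (nu p))|.
have B1 : 1 <= B by rewrite lerDl sumr_ge0.
have Bp : 0 < B by lra.
(* On the nodes, [g] is [th] after undoing [ipow B^-1]: [B] bounds every [|ln (nu p)|], so the angle
   [ln (nu p) / B] lies in [[-1, 1]], where [asin] inverts [sin]. *)
pose g (z : C) : C := th ((expR (asin (Im z) * B))%:C).
have [q Hq] := poly_interpolation [seq ipow B^-1 (nu p) | p <- l] g.
have Eq : \sum_(p <- l) q.[ipow B^-1 (nu p)] * c p = 0.
  under eq_bigr do rewrite horner_coef mulr_suml.
  rewrite exchange_big big1 //= => k _; under eq_bigr do rewrite -mulrA.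
  rewrite -mulr_sumr; have := E (k%:R * B^-1).
  by under eq_bigr do rewrite ipow_natmul; move=> ->; rewrite mulr0.
rewrite -[RHS]Eq.
rewrite big_seq [RHS]big_seq; apply: eq_bigr => p pl; congr (_ * _).
rewrite Hq; last exact: (map_f (fun p => ipow B^-1 (nu p)) pl).
rewrite /g /=; have [nuE nup] := pos_complex (nu0 p).
have bnd : `|ln (Re (nu p))| <= B.
  by rewrite /B (big_rem p pl) /= addrCA lerDl addr_ge0 // sumr_ge0.
have P2 := pi_ge2 R.
rewrite sinK; first by rewrite mulrAC mulVf ?gt_eqF // mul1r lnK // -nuE.
rewrite in_itv /= -ler_norml normrM (gtr0_norm (_ : 0 < B^-1)) ?invr_gt0 //.
rewrite ler_pdivrMl //; apply: le_trans bnd _; rewrite -[leLHS]mulr1 ler_pM2l //; lra.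
Qed.

End UnitaryPowers.

(** * Characters as families of matrices *)

Section PolAlgebra.
Local Open Scope complex_scope.
Local Open Scope sesquilinear_scope.
Variables (R : realType).
Local Notation C := R[i].
Variables (A : algType C) (Irr : eqType) (n : Irr -> nat).
Variable (u : forall s, 'M[A]_(n s)).
Variable star : A -> A.
Hypothesis H : cqg_algebra u star.
Local Notation ub := (ub u).
Local Notation idx := (idx n).

Lemma basis_normal a : exists lc : seq idx * (idx -> C),
  [/\ uniq lc.1, forall t, t \notin lc.1 -> lc.2 t = 0 &
      a = \sum_(t <- lc.1) lc.2 t *: ub t].
Proof.
have [l [c ->]] := basis_span H a.
(* [l] may repeat indices, so coefficients are multiplied by multiplicities; off [l] they are set to
   [0]. *)
exists (undup l, fun t => if t \in l then c t *+ count_mem t l else 0) => /=.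
split; first exact: undup_uniq.
  by move=> t; rewrite mem_undup => /negbTE ->.
rewrite -big_undup_iterop_count /= big_seq [RHS]big_seq.
apply: eq_bigr => t; rewrite mem_undup => tl.
by rewrite tl -scalerMnl.
Qed.

Definition bsupp a : seq idx := (sval (cid (basis_normal a))).1.
Definition bcoef a : idx -> C := (sval (cid (basis_normal a))).2.

Lemma bsupp_uniq a : uniq (bsupp a).
Proof. by have [] := svalP (cid (basis_normal a)). Qed.
Lemma bcoef_out a t : t \notin bsupp a -> bcoef a t = 0.
Proof. by have [_ h _] := svalP (cid (basis_normal a)); apply: h. Qed.
Lemma bcoefE a : a = \sum_(t <- bsupp a) bcoef a t *: ub t.
Proof. by have [] := svalP (cid (basis_normal a)). Qed.

Lemma sum_widen (M : lmodType C) (l L : seq idx) (c : idx -> C) (F : idx -> M) :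
  uniq l -> uniq L -> {subset l <= L} -> (forall t, t \notin l -> c t = 0) ->
  \sum_(t <- l) c t *: F t = \sum_(t <- L) c t *: F t.
Proof.
move=> ul uL sub c0; rewrite [RHS](bigID (mem l)) /=.
rewrite [X in _ + X]big1 ?addr0; last by move=> t tl; rewrite c0 // scale0r.
rewrite -[RHS]big_filter; apply: perm_big; apply: uniq_perm => //.
  exact: filter_uniq.
move=> t; rewrite mem_filter; apply/idP/andP => [tl|[]//]; split=> //.
exact: sub.
Qed.

Lemma bcoef_uniq a l c : uniq l -> (forall t, t \notin l -> c t = 0) ->
  a = \sum_(t <- l) c t *: ub t -> bcoef a =1 c.
Proof.
move=> ul c0 aE t; pose L := undup (bsupp a ++ l).
have uL : uniq L by apply: undup_uniq.
have s1 : {subset bsupp a <= L} by move=> x xa; rewrite mem_undup mem_cat xa.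
have s2 : {subset l <= L} by move=> x xa; rewrite mem_undup mem_cat xa orbT.
have : \sum_(t <- L) (bcoef a t - c t) *: ub t = 0.
  under eq_bigr do rewrite scalerBl.
  rewrite sumrB -(sum_widen _ (bsupp_uniq a) uL s1 (@bcoef_out a)).
  by rewrite -(sum_widen _ ul uL s2 c0) -bcoefE -aE subrr.
have [tL /(Defs.basis_free H uL)/(_ t tL) /eqP|] := boolP (t \in L).
  by rewrite subr_eq0 => /eqP.
by rewrite mem_undup mem_cat negb_or => /andP[ta tl] _; rewrite bcoef_out // c0.
Qed.

Section Extension.
Variables (M : lmodType C) (F : idx -> M).

Definition lext_fun a : M := \sum_(t <- bsupp a) bcoef a t *: F t.

Lemma lext_funE a l c : uniq l -> (forall t, t \notin l -> c t = 0) ->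
  a = \sum_(t <- l) c t *: ub t -> lext_fun a = \sum_(t <- l) c t *: F t.
Proof.
move=> ul c0 aE; have E := bcoef_uniq ul c0 aE.
pose L := undup (bsupp a ++ l).
have uL : uniq L by apply: undup_uniq.
have s1 : {subset bsupp a <= L} by move=> x xa; rewrite mem_undup mem_cat xa.
have s2 : {subset l <= L} by move=> x xa; rewrite mem_undup mem_cat xa orbT.
rewrite /lext_fun (sum_widen _ (bsupp_uniq a) uL s1 (@bcoef_out a)).
by rewrite (sum_widen _ ul uL s2 c0); apply: eq_bigr => t _; rewrite E.
Qed.

Lemma lext_is_linear : linear lext_fun.
Proof.
move=> k a b; pose L := undup (bsupp a ++ bsupp b).
have uL : uniq L by apply: undup_uniq.
have s1 : {subset bsupp a <= L} by move=> x xa; rewrite mem_undup mem_cat xa.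
have s2 : {subset bsupp b <= L} by move=> x xa; rewrite mem_undup mem_cat xa orbT.
rewrite (@lext_funE _ L (fun t => k * bcoef a t + bcoef b t)) //.
- under eq_bigr do rewrite scalerDl -scalerA.
  rewrite big_split -scaler_sumr /=; congr (k *: _ + _).
    by rewrite -(sum_widen _ (bsupp_uniq a) uL s1 (@bcoef_out a)).
  by rewrite -(sum_widen _ (bsupp_uniq b) uL s2 (@bcoef_out b)).
- move=> t; rewrite mem_undup mem_cat negb_or => /andP[ta tb].
  by rewrite !bcoef_out // mulr0 addr0.
- under eq_bigr do rewrite scalerDl -scalerA.
  rewrite big_split -scaler_sumr /=.
  rewrite -(sum_widen _ (bsupp_uniq a) uL s1 (@bcoef_out a)).
  by rewrite -(sum_widen _ (bsupp_uniq b) uL s2 (@bcoef_out b)) -!bcoefE.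
Qed.

HB.instance Definition _ := GRing.isLinear.Build C A M _ lext_fun lext_is_linear.

Lemma lext_exists : exists f : {linear A -> M}, forall t, f (ub t) = F t.
Proof.
exists lext_fun => t; rewrite /= (@lext_funE _ [:: t] (fun t' => (t' == t)%:R)) //.
- by rewrite big_seq1 eqxx scale1r.
- by move=> t'; rewrite inE => /negbTE ->.
- by rewrite big_seq1 eqxx scale1r.
Qed.

Definition lext : {linear A -> M} := sval (cid lext_exists).

Lemma lextE t : lext (ub t) = F t.
Proof. exact: svalP (cid lext_exists) t. Qed.

End Extension.

Lemma linear_ext (M : lmodType C) (f g : A -> M) : linear f -> linear g ->
  (forall s i j, f (u s i j) = g (u s i j)) -> f =1 g.
Proof.
move=> lf lg E a; have [l [c ->]] := basis_span H a.
have f0 (h : A -> M) : linear h -> h 0 = 0.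
  by move=> lh; have := lh (-1) 0 0; rewrite scaler0 addr0 scaleN1r addNr.
elim: l => [|t l IH]; first by rewrite big_nil !f0.
by rewrite big_cons lf lg IH /ub E.
Qed.

Definition ucoord (t : idx) : {linear A -> C} := lext (fun t' => (t' == t)%:R : C).

Lemma ucoord_eq0 a : (forall t, ucoord t a = 0) -> a = 0.
Proof.
move=> E; have [[l c] /= [ul c0 aE]] := basis_normal a.
rewrite aE big_seq big1 // => t tl; have := E t; rewrite aE linear_sum /=.
rewrite (bigD1_seq t) //= big1 ?addr0.
  by rewrite linearZ [ucoord t _]lextE eqxx => /eqP; rewrite mulf_eq0 oner_eq0 orbF => /eqP ->; rewrite scale0r.
by move=> t' tt'; rewrite linearZ [ucoord t _]lextE (negbTE tt') [LHS]mulr0.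
Qed.

Lemma ucoord_inj a b : (forall t, ucoord t a = ucoord t b) -> a = b.
Proof.
move=> E; apply/eqP; rewrite -subr_eq0; apply/eqP/ucoord_eq0 => t.
by rewrite linearB /= E subrr.
Qed.

Definition fam := forall s, 'M[C]_(n s).
Implicit Types X Y P : fam.

Definition fn X : {linear A -> C} :=
  lext (fun t => X (tag t) (tagged t).1 (tagged t).2 : C).
(** Right convolution [(id (x) fn X) o Delta], written on the basis because the coproduct is only
    available through functionals. *)
Definition Lop X : {linear A -> A} :=
  lext (fun t => \sum_k X (tag t) k (tagged t).2 *: u (tag t) (tagged t).1 k).

Lemma fnE X s i j : fn X (u s i j) = X s i j.
Proof. exact: (lextE _ (Tagged (fun s => ('I_(n s) * 'I_(n s))%type) (i, j))). Qed.
Lemma LopE X s i j : Lop X (u s i j) = \sum_k X s k j *: u s i k.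
Proof. exact: (lextE _ (Tagged (fun s => ('I_(n s) * 'I_(n s))%type) (i, j))). Qed.

Lemma fn_lin X : lin_fun (fn X). Proof. exact: linearP. Qed.
Lemma lin_fun_fn (f : A -> C) : lin_fun f -> f = fn (Xphi u f).
Proof.
move=> lf; apply/funext; apply: linear_ext => //; first exact: linearP.
by move=> s i j; rewrite fnE mxE.
Qed.

Lemma eq_fn X Y : (forall s, X s = Y s) -> forall a, fn X a = fn Y a.
Proof. by move=> E a; have -> // : X = Y by apply: functional_extensionality_dep. Qed.
Lemma eq_Lop X Y : (forall s, X s = Y s) -> forall a, Lop X a = Lop Y a.
Proof. by move=> E a; have -> // : X = Y by apply: functional_extensionality_dep. Qed.

Definition famM X Y : fam := fun s => X s *m Y s.
Definition fam1 : fam := fun s => 1%:M.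

Lemma Lop_comp X Y a : Lop X (Lop Y a) = Lop (famM X Y) a.
Proof.
apply: (@linear_ext _ (Lop X \o Lop Y)); try exact: linearP.
move=> s i j /=; rewrite !LopE linear_sum.
under eq_bigr do rewrite linearZ /= LopE scaler_sumr.
rewrite exchange_big /=; apply: eq_bigr => k _.
rewrite mxE scaler_suml; apply: eq_bigr => l _.
by rewrite scalerA mulrC.
Qed.

Lemma fn_Lop X Y a : fn X (Lop Y a) = fn (famM X Y) a.
Proof.
apply: (@linear_ext _ (fn X \o Lop Y)); try exact: linearP.
move=> s i j /=; rewrite fnE LopE linear_sum mxE.
by apply: eq_bigr => k _; rewrite linearZ /= fnE mulrC.
Qed.

Lemma Lop1 a : Lop fam1 a = a.
Proof.
apply: (@linear_ext _ (Lop fam1) id) => //; first exact: linearP.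
move=> s i j; rewrite LopE (bigD1 j) //= big1 ?addr0; first by rewrite mxE eqxx scale1r.
by move=> k kj; rewrite mxE (negbTE kj) scale0r.
Qed.

(** * Characters: products, inverses and adjoints *)

Definition chr X := (forall a b, fn X (a * b) = fn X a * fn X b) /\ fn X 1 = 1.
Definition alg_hom (f : A -> A) := (forall a b, f (a * b) = f a * f b) /\ f 1 = 1.

Lemma eq_chr X Y : (forall s, X s = Y s) -> chr X -> chr Y.
Proof. by move=> E; have -> // : X = Y by apply: functional_extensionality_dep. Qed.

Lemma chr1 : chr fam1.
Proof.
have [] := counit_mul H (fn_lin fam1); last by split.
by move=> s i j; rewrite fnE mxE.
Qed.

Lemma is_conv_coord X t : is_conv u (ucoord t) (fn X) (ucoord t \o Lop X).
Proof.
move=> s i j /=; rewrite LopE linear_sum; apply: eq_bigr => k _.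
by rewrite linearZ /= fnE mulrC.
Qed.

Lemma comp_coord_lin X t : lin_fun (ucoord t \o Lop X).
Proof. exact: linearP. Qed.

(** The coproduct axioms are tested on pairs of functionals; with [ucoord t] on the left and [fn X]
    on the right they give the [t]-coordinate of each required identity. *)
Lemma chr_alg_hom X : chr X -> alg_hom (Lop X).
Proof.
move=> [XM X1]; split; last first.
  apply: ucoord_inj => t.
  have := coprod_unit H (linearP _) (fn_lin X) (comp_coord_lin X t) (is_conv_coord X t).
  by rewrite X1 mulr1.
move=> a b; move: a; apply: linear_ext.
- by move=> k x y; rewrite mulrDl -scalerAl linearP.
- by move=> k x y; rewrite linearP mulrDl -scalerAl.
move=> s i j; move: b; apply: linear_ext.
- by move=> k x y; rewrite mulrDr -scalerAr linearP.
- by move=> k x y; rewrite linearP mulrDr -scalerAr.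
move=> s' k l; apply: ucoord_inj => t.
have := coprod_mul H (linearP _) (fn_lin X) (comp_coord_lin X t) (is_conv_coord X t).
move=> /(_ _ _ i j k l) /= ->; rewrite !LopE mulr_suml linear_sum.
apply: eq_bigr => p _; rewrite mulr_sumr linear_sum; apply: eq_bigr => q _.
by rewrite -scalerAr -scalerAl scalerA linearZ /= XM !fnE mulrC [X s' _ _ * _]mulrC.
Qed.

(** [fn X] is the counit [fn fam1] composed with [Lop X]. *)
Lemma alg_hom_chr X : alg_hom (Lop X) -> chr X.
Proof.
have E a : fn X a = fn fam1 (Lop X a).
  by rewrite fn_Lop; apply: eq_fn => s; rewrite /famM mul1mx.
move=> [hM h1]; have [oM o1] := chr1.
by split=> [a b|]; rewrite !E ?hM ?oM // h1.
Qed.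

Lemma chrM X Y : chr X -> chr Y -> chr (famM X Y).
Proof.
move=> [XM X1] /chr_alg_hom[YM Y1].
by split=> [a b|]; rewrite -!fn_Lop ?YM ?XM // Y1.
Qed.

Definition famstar X : fam := fun s => \matrix_(i, j) fn X (star (u s j i)).

Lemma famstar_inv X s : chr X -> X s *m famstar X s = 1%:M.
Proof.
move=> [XM X1]; apply/matrixP => i j; have [/matrixP/(_ i j) E _] := u_unitary H s.
move: E; rewrite !mxE => /(congr1 (fn X)).
rewrite linear_sum; under eq_bigr do rewrite !mxE XM fnE.
under [in X in _ -> X]eq_bigr do rewrite mxE.
by move=> ->; case: (i == j) => /=; rewrite ?X1 ?linear0.
Qed.

Lemma chr_unit X s : chr X -> X s \in unitmx.
Proof. by move=> /(famstar_inv s)/mulmx1_unit[]. Qed.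

Lemma famstar_invmx X s : chr X -> famstar X s = invmx (X s).
Proof.
move=> cX; have Xu := chr_unit s cX.
by rewrite -[famstar X s](mulKmx Xu) famstar_inv // mulmx1.
Qed.

Definition famV X : fam := fun s => invmx (X s).

(** [Lop (famV X)] is the inverse map of the algebra endomorphism [Lop X], hence itself a
    homomorphism. *)
Lemma chrV X : chr X -> chr (famV X).
Proof.
move=> cX; have [LM L1] := chr_alg_hom cX.
have K1 a : Lop X (Lop (famV X) a) = a.
  rewrite Lop_comp -[RHS]Lop1; apply: eq_Lop => s.
  by rewrite /famM mulmxV // chr_unit.
have K2 a : Lop (famV X) (Lop X a) = a.
  rewrite Lop_comp -[RHS]Lop1; apply: eq_Lop => s.
  by rewrite /famM mulVmx // chr_unit.
apply: alg_hom_chr; split=> [a b|]; first by rewrite -[RHS]K2 LM !K1.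
by rewrite -[RHS]K2 L1.
Qed.

Lemma star1 : star 1 = 1.
Proof. by have := star_antimul H (star 1) 1; rewrite mulr1 !(star_invol H) mulr1 => <-. Qed.

Definition famadj X : fam := fun s => (X s)^t*.

(** The map [a |-> conj (fn X (star a))] is a character. Its family [Z] is the adjoint of the
    inverse of [X], by [famstar_invmx], so [chrV] turns it into the adjoint of [X]. *)
Lemma chr_adj X : chr X -> chr (famadj X).
Proof.
move=> cX; pose Z : fam := fun s => (invmx (X s))^t*.
have ZE a : fn Z a = (fn X (star a))^*%R.
  move: a; apply: linear_ext; first exact: linearP.
    by move=> k a b; rewrite (star_antilin H) linearP rmorphD rmorphM /= conjCK.
  by move=> s i j; rewrite fnE !mxE -famstar_invmx // mxE.
have cZ : chr Z.
  have [XM X1] := cX; split=> [a b|]; rewrite !ZE.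
    by rewrite (star_antimul H) XM rmorphM mulrC.
  by rewrite star1 X1 rmorph1.
apply: eq_chr (chrV cZ) => s; rewrite /famV /Z /famadj.
by rewrite -map_invmx -trmx_inv invmxK.
Qed.


(** * Eigenvectors of convolution operators and unitarity of bounded characters *)

Definition tg s (i j : 'I_(n s)) : idx := Tagged (fun s => ('I_(n s) * 'I_(n s))%type) (i, j).

Lemma ucoord_same s (i j i' j' : 'I_(n s)) :
  ucoord (tg i j) (u s i' j') = ((i' == i) && (j' == j))%:R.
Proof. by rewrite [LHS](lextE _ (tg i' j')) /tg eq_Tagged. Qed.

Lemma ucoord_diff s s' (i j : 'I_(n s)) (i' j' : 'I_(n s')) : s' != s ->
  ucoord (tg i j) (u s' i' j') = 0.
Proof.
move=> ss; rewrite [LHS](lextE _ (tg i' j')); case: eqP => // /(congr1 tag) /= E.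
by rewrite E eqxx in ss.
Qed.

(** The coordinates of [a] along row [i] of [u s], on which [Lop P] acts as the matrix [P s].
    Conversely [ev] below carries eigenvectors of [P s] to eigenvectors of [Lop P]. *)
Definition cvec s (i : 'I_(n s)) a : 'cV[C]_(n s) := \col_j ucoord (tg i j) a.

Lemma cvec_Lop P s (i : 'I_(n s)) a : cvec i (Lop P a) = P s *m cvec i a.
Proof.
apply/colP => k; rewrite !mxE.
under eq_bigr do rewrite mxE.
move: a; apply: (@linear_ext _ (ucoord (tg i k) \o Lop P)).
- exact: linearP.
- move=> c a b; rewrite /= -[X in _ = X + _]/(c * _) mulr_sumr -big_split /=.
  by apply: eq_bigr => j _; rewrite linearP mulrDr mulrCA.
move=> s' i' j' /=; rewrite LopE linear_sum.
have [E|ss] := eqVneq s' s; last first.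
  rewrite [LHS]big1 => [|j _]; last by rewrite linearZ /= ucoord_diff // [LHS]mulr0.
  by rewrite big1 // => j _; rewrite ucoord_diff // mulr0.
subst s'; rewrite (bigD1 k) //= [RHS](bigD1 j') //= !big1.
- by rewrite linearZ /= !ucoord_same !eqxx.
- by move=> j jj; rewrite ucoord_same eq_sym [j' == j]eq_sym (negbTE jj) andbF mulr0.
- by move=> j jj; rewrite linearZ /= ucoord_same (negbTE jj) andbF [LHS]mulr0.
Qed.

Lemma cvec_eq0 a : (forall s (i : 'I_(n s)), cvec i a = 0) -> a = 0.
Proof.
move=> E; apply: ucoord_eq0 => -[s [i j]].
by have /colP/(_ j) := E s i; rewrite !mxE.
Qed.

Lemma cvecZ s (i : 'I_(n s)) c a : cvec i (c *: a) = c *: cvec i a.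
Proof. by apply/colP => j; rewrite !mxE linearZ. Qed.

Lemma cvecB s (i : 'I_(n s)) a b : cvec i (a - b) = cvec i a - cvec i b.
Proof. by apply/colP => j; rewrite !mxE linearB. Qed.

Definition ev s (v : 'cV[C]_(n s)) (i : 'I_(n s)) : A := \sum_j v j 0 *: u s i j.

Lemma Lop_ev P s (v : 'cV_(n s)) i : Lop P (ev v i) = ev (P s *m v) i.
Proof.
rewrite /ev linear_sum; under eq_bigr do rewrite linearZ /= LopE scaler_sumr.
rewrite exchange_big /=; apply: eq_bigr => k _; rewrite mxE scaler_suml.
by apply: eq_bigr => j _; rewrite scalerA mulrC.
Qed.

Lemma evZ s c (v : 'cV_(n s)) i : ev (c *: v) i = c *: ev v i.
Proof. by rewrite /ev scaler_sumr; apply: eq_bigr => j _; rewrite mxE scalerA. Qed.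

(** Multiplying by [star (u s i k)] on the left and summing over [i] cancels [u] by unitarity and
    leaves [v k 0 *: a]. *)
Lemma ev_regular s (v : 'cV_(n s)) a : v != 0 -> (forall i, ev v i * a = 0) -> a = 0.
Proof.
move=> v0 E; apply/eqP; apply: contraR v0 => a0; apply/eqP/colP => k; rewrite mxE.
have : \sum_i star (u s i k) * (ev v i * a) = 0 by rewrite big1 // => i _; rewrite E mulr0.
under eq_bigr do rewrite /ev mulr_suml mulr_sumr.
rewrite exchange_big /=.
have U j : \sum_i star (u s i k) * u s i j = (k == j)%:R.
  have [_ /matrixP/(_ k j)] := u_unitary H s.
  by rewrite !mxE => <-; apply: eq_bigr => i _; rewrite !mxE.
have -> : \sum_j \sum_i star (u s i k) * (v j 0 *: u s i j * a) = v k 0 *: a.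
  rewrite (bigD1 k) //= [X in _ + X]big1 => [|j jk]; last first.
    under eq_bigr do rewrite -scalerAl -scalerAr mulrA.
    by rewrite -scaler_sumr -mulr_suml U eq_sym (negbTE jk) mul0r scaler0.
  under eq_bigr do rewrite -scalerAl -scalerAr mulrA.
  by rewrite -scaler_sumr -mulr_suml U eqxx mul1r addr0.
by move=> /eqP; rewrite scaler_eq0 (negbTE a0) orbF => /eqP.
Qed.

Lemma Lop_eigenvector P a nu : a != 0 -> Lop P a = nu *: a ->
  exists s, exists2 v : 'cV_(n s), v != 0 & P s *m v = nu *: v.
Proof.
move=> a0 E; have [s [i ai]] : exists s, exists i : 'I_(n s), cvec i a != 0.
  apply: contrapT => NE; move/eqP: a0; apply; apply: cvec_eq0 => s i.
  by apply/eqP; apply: contrapT => /negP h; apply: NE; exists s, i.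
by exists s, (cvec i a); rewrite // -cvec_Lop E cvecZ.
Qed.

(** [Lop P] is multiplicative, so multiplying an eigenvector by [ev v i] multiplies its eigenvalue
    by [lam]; [ev_regular] supplies an [i] with nonzero product. *)
Lemma Lop_eigen_pow P s (v : 'cV_(n s)) lam k : chr P -> v != 0 -> P s *m v = lam *: v ->
  exists2 a, a != 0 & Lop P a = lam ^+ k *: a.
Proof.
move=> /chr_alg_hom[LM L1] v0 Pv; elim: k => [|k [a a0 La]].
  by exists 1; rewrite ?oner_neq0 // L1 expr0 scale1r.
have [i vi] : exists i, ev v i * a != 0.
  apply: contrapT => NE; move/eqP: a0; apply; apply: (ev_regular v0) => i.
  by apply/eqP; apply: contrapT => /negP h; apply: NE; exists i.
exists (ev v i * a) => //.
by rewrite LM La Lop_ev Pv evZ -scalerAl -scalerAr scalerA exprS.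
Qed.

(* Powers of an eigenvalue occur again as eigenvalues (in the constituents of
   tensor powers), so a uniform bound on all eigenvalues forces them into the disc. *)
Lemma eigen_le1 P (M : R) : chr P ->
  (forall s (v : 'cV_(n s)) nu, v != 0 -> P s *m v = nu *: v -> `|nu| <= M%:C) ->
  forall s (v : 'cV_(n s)) nu, v != 0 -> P s *m v = nu *: v -> `|nu| <= 1.
Proof.
move=> cP bd s v nu v0 Pv.
have pw k : `|nu| ^+ k <= M%:C.
  have [a a0 La] := Lop_eigen_pow k cP v0 Pv.
  have [r [w w0 Pw]] := Lop_eigenvector a0 La.
  by rewrite -normrX; apply: bd Pw.
move: pw; rewrite normc_def; set x := Num.sqrt _ => pw.
have x0 : 0 <= x by apply: sqrtr_ge0.
rewrite -[1]/(1%:C) lecR leNgt; apply/negP => x1.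
have q01 : 0 <= x^-1 < 1 by rewrite invr_ge0 x0 invf_lt1 // (lt_trans _ x1).
have M0 : 1 <= M by have := pw 0%N; rewrite expr0 -[1]/(1%:C) lecR.
have e0 : 0 < (M + 1)^-1 by rewrite invr_gt0; lra.
have [k] := geometric_small 1 q01 e0; rewrite mulr1 exprVn lef_pV2 ?posrE; last 2 first.
  by rewrite exprn_gt0 // (lt_trans _ x1).
  by lra.
have := pw k; rewrite -rmorphXn lecR; lra.
Qed.

Lemma Lop_star P s (i j : 'I_(n s)) : chr P ->
  Lop P (star (u s i j)) = \sum_k invmx (P s) j k *: star (u s i k).
Proof.
move=> cP; apply: ucoord_inj => t.
have := coprod_star H (linearP _) (fn_lin P) (comp_coord_lin P t) (is_conv_coord P t).
move=> /(_ _ i j) /= ->; rewrite linear_sum; apply: eq_bigr => k _.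
by rewrite linearZ /= -famstar_invmx // mxE mulrC.
Qed.

(** By [Lop_star] the adjoints [star (u s i j)] transform under the inverse of [P s], so
    [a i = \sum_j y 0 j *: star (u s i j)] satisfies the eigenvalue equation for [lam^-1]. Not all
    [a i] vanish, because [\sum_i a i * u s i k = y 0 k *: 1]. *)
Lemma eigen_inv P s (y : 'rV_(n s)) lam : chr P -> y != 0 -> y *m P s = lam *: y ->
  exists r, exists2 v : 'cV_(n r), v != 0 & P r *m v = lam^-1 *: v.
Proof.
move=> cP y0 yP; have Pu := chr_unit s cP.
have lam0 : lam != 0.
  by apply: contra y0 => /eqP l0; rewrite -(mulmxK Pu y) yP l0 scale0r mul0mx.
have yV : y *m invmx (P s) = lam^-1 *: y.
  by rewrite -[y in RHS](mulmxK Pu) yP -scalemxAl scalerA mulVf // scale1r.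
pose a i := \sum_j y 0 j *: star (u s i j).
have La i : Lop P (a i) = lam^-1 *: a i.
  rewrite /a linear_sum; under eq_bigr do rewrite linearZ /= Lop_star // scaler_sumr.
  rewrite exchange_big scaler_sumr /=; apply: eq_bigr => k _; rewrite scalerA.
  have /matrixP/(_ 0 k) := yV; rewrite !mxE => <-; rewrite scaler_suml.
  by apply: eq_bigr => j _; rewrite scalerA.
have [i ai] : exists i, a i != 0.
  apply: contrapT => NE; move/eqP: y0; apply; apply/rowP => k; rewrite mxE.
  have : \sum_i a i * u s i k = 0.
    rewrite big1 // => i _; have -> : a i = 0; last by rewrite mul0r.
    by apply/eqP; apply: contrapT => /negP h; apply: NE; exists i.
  under eq_bigr do rewrite /a mulr_suml.
  rewrite exchange_big /=.
  have U j : \sum_i star (u s i j) * u s i k = (j == k)%:R.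
    have [_ /matrixP/(_ j k)] := u_unitary H s.
    by rewrite !mxE => <-; apply: eq_bigr => i _; rewrite !mxE.
  have -> : \sum_j \sum_i y 0 j *: star (u s i j) * u s i k = y 0 k *: 1.
    rewrite (bigD1 k) //= [X in _ + X]big1 => [|j jk]; last first.
      under eq_bigr do rewrite -scalerAl.
      by rewrite -scaler_sumr U (negbTE jk) scaler0.
    under eq_bigr do rewrite -scalerAl.
    by rewrite -scaler_sumr U eqxx addr0.
  by move=> /eqP; rewrite scaler_eq0 oner_eq0 orbF => /eqP.
exact: Lop_eigenvector ai (La i).
Qed.

Definition famgram X : fam := fun s => (X s)^t* *m X s.

Lemma chr_gram X : chr X -> chr (famgram X).
Proof. by move=> cX; apply: (chrM (chr_adj cX) cX). Qed.

(** Since [<X v, X v> = nu |v|^2], testing the bound on [v] and [X v] gives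
    [nu^2 |v|^4 <= M^2 nu |v|^4]. *)
Lemma opnorm_gram m (X : 'M[C]_m) (M : R) (v : 'cV_m) nu :
  opnorm_le X M -> v != 0 -> X^t* *m X *m v = nu *: v -> `|nu| <= (M ^+ 2)%:C.
Proof.
move=> /(_ v (X *m v)) op v0 E.
have vp := sqnorm_gt0 v0.
have N : (\sum_i `|(X *m v) i 0| ^+ 2) = nu * (v^t* *m v) 0 0.
  by rewrite -sqnormE adj_mulmx -mulmxA (mulmxA _ X) E -scalemxAr mxE.
have nu0 : 0 <= nu.
  by rewrite -(pmulr_lge0 _ vp) -N sumr_ge0 // => i _; rewrite exprn_ge0.
have S : \sum_i \sum_j ((X *m v) i 0)^*%R * X i j * v j 0 = nu * (v^t* *m v) 0 0.
  rewrite -N; apply: eq_bigr => i _; under eq_bigr do rewrite -mulrA.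
  by rewrite -mulr_sumr normCK [RHS]mulrC; congr (_ * _); rewrite mxE.
move: op; rewrite S N -sqnormE normrM !ger0_norm ?(ltW vp) //.
set w := (_ *m _) 0 0 in vp *.
have [->|nun] := eqVneq nu 0; first by rewrite -[0]/(0%:C) lecR sqr_ge0.
have nup : 0 < nu by rewrite lt0r nun.
have -> : (nu * w) ^+ 2 = nu * (nu * w * w) by ring.
have -> : M%:C ^+ 2 * w * (nu * w) = M%:C ^+ 2 * (nu * w * w) by ring.
by rewrite ler_pM2r ?rmorphXn // !mulr_gt0.
Qed.

(** The eigenvalues of [X^*X] are positive and at most [1] by [eigen_le1]. So are their inverses,
    which by [eigen_inv] are eigenvalues in some component; hence all equal [1]. *)
Lemma bounded_unitary X (M : R) : chr X -> (forall s, opnorm_le (X s) M) ->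
  forall s, X s \is unitarymx.
Proof.
move=> cX bd s; apply: unitarymx_adj; have cP := chr_gram cX.
have le1 := eigen_le1 cP (fun s v nu v0 E => opnorm_gram (bd s) v0 E).
have nP := gram_normal (X s).
rewrite -(fcalc_id nP); apply: fcalc_cst1 => l; set d := spectral_diag _ _ _.
have d0 : 0 < d by apply: gram_spectral_gt0; apply: chr_unit.
have c0 := col_unit_neq0 l (etrans (unitmx_inv _) (spectral_unit (famgram X s))).
have d1 := le1 _ _ _ c0 (spectral_col l nP).
have r0 := row_unit_neq0 l (spectral_unit (famgram X s)).
have [r [w w0 Pw]] := eigen_inv cP r0 (spectral_row l nP).
have := le1 _ _ _ w0 Pw; rewrite normfV ger0_norm ?(ltW d0) // => d2.
rewrite ger0_norm ?(ltW d0) // in d1.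
apply/eqP; rewrite eq_le d1 /=.
by rewrite invf_le1 in d2.
Qed.

Lemma unitary_sqnorm m (X : 'M[C]_m) (v : 'cV_m) : X \is unitarymx ->
  \sum_i `|(X *m v) i 0| ^+ 2 = \sum_i `|v i 0| ^+ 2.
Proof.
move=> Xu; rewrite -!sqnormE adj_mulmx -mulmxA (mulmxA _ X).
by rewrite -invmx_unitary // mulVmx ?mul1mx // unitarymx_unit.
Qed.

Lemma unitary_opnorm m (X : 'M[C]_m) : X \is unitarymx -> opnorm_le X 1.
Proof.
move=> Xu v w; rewrite expr1n mul1r -(unitary_sqnorm v Xu).
(* Transposed because [dotmx] is an inner product of row vectors; the bound is Cauchy-Schwarz. *)
pose a := (X *m v)^T; pose b := w^T.
have : `|dotmx a b| ^+ 2 <= dotmx a a * dotmx b b.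
  by have [] := CauchySchwarz (@dotmx C m) a b.
have D (x y : 'cV[C]_m) : dotmx x^T y^T = \sum_i x i 0 * (y i 0)^*%R.
  by rewrite dotmxE !mxE; apply: eq_bigr => i _; rewrite !mxE.
rewrite !D; congr (_ <= _).
  congr (`|_| ^+ 2); apply: eq_bigr => i _; rewrite mxE mulr_suml.
  by apply: eq_bigr => j _; rewrite mulrC mulrA.
by congr (_ * _); apply: eq_bigr => i _; rewrite normCK.
Qed.

Lemma unitary_entry m (X : 'M[C]_m) i j : X \is unitarymx -> `|X i j| <= 1.
Proof.
move=> Xu; rewrite -(@expr_le1 _ 2) //.
have := unitary_sqnorm (delta_mx j 0 : 'cV_m) Xu.
rewrite -colE; under eq_bigr do rewrite mxE.
rewrite [RHS](bigD1 j) //= mxE !eqxx normr1 expr1n [X in _ + X]big1 ?addr0 => [<-|k kj].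
  by rewrite (bigD1 i) //= lerDl sumr_ge0 // => k _; rewrite exprn_ge0.
by rewrite mxE (negbTE kj) normr0 expr0n.
Qed.

(** * Functional calculus on the positive character [X^*X] *)

Section Positive.
Variable X : fam.
Hypothesis cX : chr X.
Local Notation P := (famgram X).
Let Pn s : P s \is normalmx := gram_normal (X s).

Definition famcalc (th : C -> C) : fam := fun s => fcalc th (P s).

(** Every [cvec i a] satisfies the eigenvalue equation of [P s] for the same [nu], so [fcalc_eigen]
    applies in each component. *)
Lemma Lop_famcalc th a nu : Lop P a = nu *: a -> Lop (famcalc th) a = th nu *: a.
Proof.
move=> E; apply/eqP; rewrite -subr_eq0; apply/eqP/cvec_eq0 => s i.
rewrite cvecB cvecZ cvec_Lop (@fcalc_eigen _ _ th _ _ nu) ?subrr ?Pn //.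
by rewrite -cvecZ -E cvec_Lop.
Qed.

Definition eigen_sum a := exists l : seq (C * A),
  (forall p, p \in l -> 0 < p.1 /\ Lop P p.2 = p.1 *: p.2) /\ a = \sum_(p <- l) p.2.

Lemma eigen_sum_lin k a b : eigen_sum a -> eigen_sum b -> eigen_sum (k *: a + b).
Proof.
move=> [l [Hl ->]] [l' [Hl' ->]]; exists ([seq (p.1, k *: p.2) | p <- l] ++ l').
split=> [p|]; last by rewrite big_cat big_map scaler_sumr.
rewrite mem_cat => /orP[/mapP[q /Hl[q0 Lq] ->]|/Hl'//] /=.
by split=> //; rewrite linearZ /= Lq !scalerA mulrC.
Qed.

(** [Lop P] is diagonalisable: each [u s i j] is a combination of the elements [ev w i], where [w]
    runs over the eigenbasis of [P s] formed by the columns of [invmx V]. *)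
Lemma eigen_sumP a : eigen_sum a.
Proof.
have z : eigen_sum 0 by exists [::]; split=> //; rewrite big_nil.
have [l [c ->]] := basis_span H a.
elim: l => [|[s [i j]] l IH]; first by rewrite big_nil.
rewrite big_cons; apply: eigen_sum_lin => //; rewrite /ub /= {IH l c a}.
pose V := spectralmx (P s); have Vu : V \in unitmx := spectral_unit _.
have -> : u s i j = \sum_l V l j *: ev (col l (invmx V)) i.
  under eq_bigr do rewrite /ev scaler_sumr.
  rewrite exchange_big /= (bigD1 j) //= [X in _ + X]big1 ?addr0 => [|k kj].
    under eq_bigr do rewrite scalerA mxE mulrC.
    have /matrixP/(_ j j) := mulVmx Vu; rewrite !mxE eqxx => E.
    by rewrite -scaler_suml E scale1r.
  under eq_bigr do rewrite scalerA mxE mulrC.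
  have /matrixP/(_ k j) := mulVmx Vu; rewrite !mxE (negbTE kj) => E.
  by rewrite -scaler_suml E scale0r.
elim/big_rec: _ => // l b _ IH; apply: eigen_sum_lin => //.
exists [:: (spectral_diag (P s) 0 l, ev (col l (invmx V)) i)]; split; last by rewrite big_seq1.
move=> p; rewrite inE => /eqP -> /=; split; first by rewrite gram_spectral_gt0 // chr_unit.
by rewrite Lop_ev spectral_col // evZ.
Qed.

Lemma linear_eigen_ext (M : lmodType C) (f g : A -> M) : linear f -> linear g ->
  (forall a nu, 0 < nu -> Lop P a = nu *: a -> f a = g a) -> f =1 g.
Proof.
move=> lf lg E a; have [l [Hl ->]] := eigen_sumP a.
have f0 (h : A -> M) : linear h -> h 0 = 0.
  by move=> lh; have := lh (-1) 0 0; rewrite scaler0 addr0 scaleN1r addNr.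
elim: l Hl => [_|p l IH Hl]; first by rewrite big_nil !f0.
rewrite big_cons -[p.2]scale1r lf lg IH => [|q ql]; last by apply: Hl; rewrite inE ql orbT.
by congr (_ *: _ + _); have [p0 Lp] := Hl p (mem_head _ _); apply: E p0 Lp.
Qed.

(** The product of elements with [Lop P]-eigenvalues [nu] and [mu] has eigenvalue [nu * mu]. As
    eigenvectors span [A], a multiplicative [th] makes [Lop (famcalc th)] an algebra
    homomorphism. *)
Lemma chr_famcalc th : th 1 = 1 ->
  (forall x y, 0 < x -> 0 < y -> th (x * y) = th x * th y) -> chr (famcalc th).
Proof.
move=> th1 thM; have [LM L1] := chr_alg_hom (chr_gram cX).
apply: alg_hom_chr; split; last first.
  by rewrite (@Lop_famcalc th _ 1) ?th1 ?scale1r // L1.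
move=> a b; move: a; apply: linear_eigen_ext.
- by move=> k x y; rewrite mulrDl -scalerAl linearP.
- by move=> k x y; rewrite linearP mulrDl -scalerAl.
move=> a nu nu0 La; move: b; apply: linear_eigen_ext.
- by move=> k x y; rewrite mulrDr -scalerAr linearP.
- by move=> k x y; rewrite linearP mulrDr -scalerAr.
move=> b mu mu0 Lb; rewrite (Lop_famcalc th La) (Lop_famcalc th Lb).
rewrite (@Lop_famcalc th _ (nu * mu)) ?thM //; last by rewrite LM La Lb -scalerAl -scalerAr scalerA.
by rewrite -scalerAl -scalerAr scalerA.
Qed.

Lemma famcalc_unitary th s : (forall x, 0 < x -> (th x)^*%R * th x = 1) ->
  famcalc th s \is unitarymx.
Proof.
move=> E; apply: unitarymx_adj; rewrite /famcalc fcalc_adj fcalcM.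
by apply: fcalc_cst1 => l; rewrite E // gram_spectral_gt0 // chr_unit.
Qed.

(** [U = X |X|^-1]; the factor [|X|^-1] is a character because the inverse square root is
    multiplicative on positive numbers. *)
Lemma polar_unitary : exists U, [/\ chr U, forall s, U s \is unitarymx &
  forall s, X s = famM U (famcalc sqrtC) s].
Proof.
pose isq (x : C) := (sqrtC x)^-1.
have sqM (x y : C) : 0 < x -> 0 < y -> sqrtC (x * y) = sqrtC x * sqrtC y.
  by move=> x0 y0; rewrite rootCMl // ltW.
have d0 s l : 0 < spectral_diag (P s) 0 l by rewrite gram_spectral_gt0 // chr_unit.
exists (famM X (famcalc isq)); split.
- apply: chrM => //; apply: chr_famcalc; rewrite /isq ?sqrtC1 ?invr1 // => x y x0 y0.
  by rewrite sqM // invfM.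
- move=> s; apply: polar_unitarymx => [|d dp]; first exact: chr_unit.
  have sp : 0 < sqrtC d by rewrite sqrtC_gt0.
  rewrite /isq (CrealP _) ?rpredV ?gtr0_real // -{2}[d]sqrtCK expr2 -mulrA mulfV ?gt_eqF //.
  by rewrite mulr1 mulVf // gt_eqF.
- move=> s; rewrite /famM -mulmxA /famcalc fcalcM fcalc_cst1 ?mulmx1 // => l.
  by rewrite /isq mulVf // gt_eqF // sqrtC_gt0.
Qed.

End Positive.

(* Unitary characters are Zariski dense: along [U * |X|^{it}] a function of the
   form [sum_p th (nu p) * c p] is seen at [th = ipow t], and evaluated at
   [th = sqrtC] to give the value at [X = U * |X|]. *)
Lemma chr_unitary_dense X a : chr X ->
  (forall U, chr U -> (forall s, U s \is unitarymx) -> fn U a = 0) -> fn X a = 0.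
Proof.
move=> cX E; have [U [cU uU XE]] := polar_unitary cX.
have [l [Hl aE]] := eigen_sumP cX a.
have val th : fn (famM U (famcalc X th)) a = \sum_(p <- l) th p.1 * fn U p.2.
  rewrite -fn_Lop aE !linear_sum big_seq [RHS]big_seq; apply: eq_bigr => p /Hl[p0 Lp].
  by rewrite (Lop_famcalc th Lp) linearZ.
rewrite (eq_fn XE) val.
(* [ipow_separates] asks for positivity at every [p]; the default [1] is never taken on [l]. *)
pose nu (p : C * A) := if 0 < p.1 then p.1 else 1.
have -> : \sum_(p <- l) sqrtC p.1 * fn U p.2 = \sum_(p <- l) sqrtC (nu p) * fn U p.2.
  by rewrite big_seq [RHS]big_seq; apply: eq_bigr => p /Hl[p0 _]; rewrite /nu p0.
apply: (@ipow_separates _ _ l nu (fun p => fn U p.2)) => [p|t].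
  by rewrite /nu; case: ifP.
have -> : \sum_(p <- l) ipow t (nu p) * fn U p.2 = \sum_(p <- l) ipow t p.1 * fn U p.2.
  by rewrite big_seq [RHS]big_seq; apply: eq_bigr => p /Hl[p0 _]; rewrite /nu p0.
rewrite -val; apply: E.
  apply: chrM => //; apply: chr_famcalc => //; first exact: ipow1.
  by move=> x y; apply: ipowM.
move=> s; apply: mul_unitarymx => //; apply: famcalc_unitary => // x _.
exact: ipow_unit.
Qed.

End PolAlgebra.

(** * Representations concentrated near the identity *)

Section ComplexNorm.
Local Open Scope complex_scope.
Local Open Scope sesquilinear_scope.
Variable R : realType.
Local Notation C := R[i].
Local Notation Re := (@complex.Re R).
Local Notation Im := (@complex.Im R).

Lemma normr_normc (z : C) : `|z| = (normc z)%:C. Proof. by []. Qed.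

Lemma normc_add (x y : C) : normc (x + y) <= normc x + normc y.
Proof. exact: le_normcD. Qed.

Lemma normc_opp (x : C) : normc (- x) = normc x.
Proof. exact: normcN. Qed.

Lemma normc_ge0 (z : C) : 0 <= normc z.
Proof. by case: z => a b; apply: sqrtr_ge0. Qed.

Lemma le_Re_normc (z : C) : `|Re z| <= normc z.
Proof. by have := normc_ge_Re z; rewrite normr_normc lecR. Qed.

Lemma le_Im_normc (z : C) : `|Im z| <= normc z.
Proof. by case: z => a b /=; rewrite -sqrtr_sqr ler_sqrt ?addr_ge0 ?sqr_ge0 // lerDr sqr_ge0. Qed.

Lemma normc_le_ReIm (z : C) : normc z <= `|Re z| + `|Im z|.
Proof.
case: z => a b /=; rewrite -[leRHS]ger0_norm ?addr_ge0 // -sqrtr_sqr.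
rewrite ler_sqrt ?sqr_ge0 // sqrrD !real_normK ?num_real //.
by rewrite lerD2r lerDl mulrn_wge0 // mulr_ge0.
Qed.

Lemma normc_sum (I : Type) (l : seq I) (P : pred I) (F : I -> C) :
  normc (\sum_(i <- l | P i) F i) <= \sum_(i <- l | P i) normc (F i).
Proof.
elim/big_ind2: _ => [|x1 x2 y1 y2 h1 h2|i _] //; first by rewrite normc0.
by apply: le_trans (normc_add _ _) (lerD h1 h2).
Qed.

Lemma ReD (x y : C) : Re (x + y) = Re x + Re y. Proof. by case: x; case: y. Qed.
Lemma ImD (x y : C) : Im (x + y) = Im x + Im y. Proof. by case: x; case: y. Qed.
Lemma ReM (x y : C) : Re (x * y) = Re x * Re y - Im x * Im y. Proof. by case: x; case: y. Qed.
Lemma ImM (x y : C) : Im (x * y) = Re x * Im y + Im x * Re y. Proof. by case: x; case: y. Qed.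
Lemma ReN (x : C) : Re (- x) = - Re x. Proof. by case: x. Qed.
Lemma ImN (x : C) : Im (- x) = - Im x. Proof. by case: x. Qed.

End ComplexNorm.

(** The colour of [x] records, for each [i], the cell of length [e] containing [F i x]; the shift by
    [B] makes the cell numbers natural. *)
Lemma bounded_coloring (R : realType) (T : Type) (I : finType) (F : I -> T -> R) (B e : R) :
  (forall i x, `|F i x| <= B) -> 0 < e ->
  exists (k : nat) (cl : T -> 'I_k), forall x y, cl x = cl y -> forall i, `|F i x - F i y| <= e.
Proof.
move=> HB e0; pose M := Num.trunc ((B + B) / e).
pose t i x := Num.trunc ((F i x + B) / e).
have F0 i x : 0 <= (F i x + B) / e.
  by rewrite divr_ge0 ?(ltW e0) //; have := HB i x; rewrite ler_norml => /andP[]; lra.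
have tM i x : (t i x < M.+1)%N.
  rewrite ltnS /M /t; apply: le_truncn.
  by rewrite ler_pM2r ?invr_gt0 // lerD2r; have := HB i x; rewrite ler_norml => /andP[].
pose cl x : {ffun I -> 'I_M.+1} := [ffun i => Ordinal (tM i x)].
exists #|{ffun I -> 'I_M.+1}|, (fun x => enum_rank (cl x)) => x y /enum_rank_inj E i.
have tE : t i x = t i y by have /ffunP/(_ i) := E; rewrite !ffunE => /(congr1 val).
have /andP[x1 x2] := truncn_itv (F0 i x); have /andP[y1 y2] := truncn_itv (F0 i y).
rewrite -/(t i x) -/(t i y) tE in x1 x2 y1 y2.
move: x1 x2 y1 y2; rewrite -natr1 !ler_pdivlMr // !ltr_pdivrMr // !mulrDl mul1r.
by rewrite ler_norml => *; apply/andP; split; lra.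
Qed.

(** * Means of complex functions and of weighted representations *)

Section ComplexMean.
Local Open Scope complex_scope.
Local Open Scope sesquilinear_scope.
Variables (R : realType) (K : Type).
Local Notation C := R[i].
Local Notation Re := (@complex.Re R).
Local Notation Im := (@complex.Im R).
Variables (mul : K -> K -> K) (one : K) (inv : K -> K).
Hypothesis G : is_group mul one inv.
Local Notation "x ** y" := (mul x y) (at level 40, left associativity).
Local Notation ap := (@almost_periodic R K mul).
Local Notation mean := (@mean R K mul).
Implicit Types f g : K -> C.

Definition cap f := ap (fun x => Re (f x)) /\ ap (fun x => Im (f x)).
Definition cmean f : C := Complex (mean (fun x => Re (f x))) (mean (fun x => Im (f x))).

Lemma ap_ext (f g : K -> R) : ap f -> f =1 g -> ap g.
Proof. by move=> + /funext E; rewrite E. Qed.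

Lemma cap_ext f g : cap f -> f =1 g -> cap g.
Proof. by move=> + /funext E; rewrite E. Qed.

Lemma cmean_ext f g : f =1 g -> cmean f = cmean g.
Proof. by move=> /funext ->. Qed.

Lemma capD f g : cap f -> cap g -> cap (fun x => f x + g x).
Proof.
move=> [rf jf] [rg jg]; split.
  by apply: ap_ext (apD rf rg) _ => x; rewrite ReD.
by apply: ap_ext (apD jf jg) _ => x; rewrite ImD.
Qed.

Lemma capM f g : cap f -> cap g -> cap (fun x => f x * g x).
Proof.
move=> [rf jf] [rg jg]; split.
  apply: ap_ext (ap_sub G (apM G rf rg) (apM G jf jg)) _ => x; by rewrite ReM.
by apply: ap_ext (apD (apM G rf jg) (apM G jf rg)) _ => x; rewrite ImM.
Qed.

Lemma cap_cst c : cap (fun=> c).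
Proof. by split; apply: ap_cst. Qed.

Lemma cap_sum (I : Type) (s : seq I) (F : I -> K -> C) :
  (forall i, cap (F i)) -> cap (fun x => \sum_(i <- s) F i x).
Proof.
move=> H; elim: s => [|i s IH].
  by apply: cap_ext (cap_cst 0) _ => x; rewrite big_nil.
by apply: cap_ext (capD (H i) IH) _ => x; rewrite big_cons.
Qed.

Lemma cmeanD f g : cap f -> cap g -> cmean (fun x => f x + g x) = cmean f + cmean g.
Proof.
move=> [rf jf] [rg jg]; rewrite /cmean.
under [X in Complex (mean X)]eq_fun do rewrite ReD.
under [X in Complex _ (mean X)]eq_fun do rewrite ImD.
by rewrite !(meanD G).
Qed.

Lemma cmeanZ c f : cap f -> cmean (fun x => c * f x) = c * cmean f.
Proof.
move=> [rf jf]; rewrite /cmean.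
under [X in Complex (mean X)]eq_fun do rewrite ReM -mulNr.
under [X in Complex _ (mean X)]eq_fun do rewrite ImM.
rewrite !(meanD G) ?(meanZ G) //; try exact: (apZ G).
by case: (c) => a b /=; rewrite mulNr.
Qed.

Lemma cmean_sum (I : Type) (s : seq I) (F : I -> K -> C) :
  (forall i, cap (F i)) -> cmean (fun x => \sum_(i <- s) F i x) = \sum_(i <- s) cmean (F i).
Proof.
move=> H; elim: s => [|i s IH].
  rewrite big_nil (cmean_ext (g := fun=> 0)) => [|x]; last by rewrite big_nil.
  by rewrite /cmean !(mean_cst G).
rewrite big_cons -IH -cmeanD //; last exact: cap_sum.
by apply: cmean_ext => x; rewrite big_cons.
Qed.

Lemma cmean_translate (g : K) f : cap f -> cmean (fun x => f (g ** x)) = cmean f.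
Proof. by move=> [rf jf]; rewrite /cmean (mean_translate G g rf) (mean_translate G g jf). Qed.

(** [rho (a x b) - rho (a y b)] equals [rho a (rho x - rho y) rho b], which is small uniformly in
    [a] and [b] when [x] and [y] have nearly equal entries; bounded entries need finitely many
    colours. *)
Lemma cap_rep m (rho : K -> 'M[C]_m) (B : R) :
  (forall x y, rho (x ** y) = rho x *m rho y) ->
  (forall x i j, normc (rho x i j) <= B) -> forall i j, cap (fun x => rho x i j).
Proof.
move=> rM rB i j.
suff apP (p : C -> R) : (forall x y, p (x - y) = p x - p y) ->
   (forall z, `|p z| <= normc z) -> ap (fun x => p (rho x i j)).
  split; apply: apP => [x y|z]; rewrite ?ReD ?ReN ?ImD ?ImN //.
    exact: le_Re_normc.
  exact: le_Im_normc.
move=> pB ple e e0.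
have B0 : 0 <= B by apply: le_trans (rB one i j); apply: normc_ge0.
(* The triple product has [m * m] terms, each at most [B * B * 2 * (e / D)]; the [+ 1] keeps [D]
   positive. *)
pose D := m%:R * m%:R * (B * B) * 2 + 1.
have D0 : 0 < D by rewrite ltr_wpDl // !mulr_ge0.
pose F (t : 'I_m * 'I_m * bool) x := if t.2 then Re (rho x t.1.1 t.1.2) else Im (rho x t.1.1 t.1.2).
have FB t x : `|F t x| <= B.
  apply: le_trans (rB x t.1.1 t.1.2); rewrite /F; case: t.2.
    exact: le_Re_normc.
  exact: le_Im_normc.
have [k [cl Hcl]] := bounded_coloring FB (divr_gt0 e0 D0).
exists k, cl => x y /Hcl E a b; rewrite -pB; apply: le_trans (ple _) _.
have dxy q r : normc ((rho x - rho y) q r) <= 2 * (e / D).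
  apply: le_trans (normc_le_ReIm _) _; rewrite !mxE ReD ReN ImD ImN.
  by have := E (q, r, true); have := E (q, r, false); rewrite /F /=; lra.
have -> : rho (a ** x ** b) i j - rho (a ** y ** b) i j =
    \sum_r \sum_q rho a i q * (rho x - rho y) q r * rho b r j.
  rewrite !rM.
  have -> : (rho a *m rho x *m rho b) i j - (rho a *m rho y *m rho b) i j
      = (rho a *m (rho x - rho y) *m rho b) i j.
    by rewrite mulmxBr mulmxBl !mxE.
  by rewrite mxE; apply: eq_bigr => r _; rewrite mxE mulr_suml.
apply: le_trans (normc_sum _ _ _) _.
apply: le_trans (_ : \sum_(r < m) \sum_(q < m) (B * (2 * (e / D)) * B) <= _).
  apply: ler_sum => r _; apply: le_trans (normc_sum _ _ _) _; apply: ler_sum => q _.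
  by rewrite !normcM; rewrite !ler_pM ?mulr_ge0 ?normc_ge0.
rewrite !sumr_const card_ord -[leLHS]mulr_natr -[X in X * _ <= _]mulr_natr.
have -> : B * (2 * (e / D)) * B * m%:R * m%:R = (m%:R * m%:R * (B * B) * 2) * (e / D) by ring.
rewrite mulrCA -[leRHS]mulr1 ler_pM2l // ler_pdivrMr // mul1r /D lerDl //.
Qed.

(** Diagonal dominance: at a coordinate [j] where a kernel vector [v] has largest modulus, [c |v_j|]
    would be at most [m] terms of size [|v_j| c / (2 (m + 1))]. *)
Lemma near_scalar_unitmx m (T : 'M[C]_m) (c : R) : 0 < c ->
  (forall i j, normc (T i j - ((i == j)%:R * c)%:C) <= c / (2 * m.+1%:R)) -> T \in unitmx.
Proof.
move=> c0 HT; rewrite unitmxE unitfE; apply/negP => /det0P[v v0 vT].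
have [i0 vi0] : exists i, v 0 i != 0.
  apply/existsP; apply: contraR v0; rewrite negb_exists => /forallP E.
  by apply/eqP/rowP => j; rewrite mxE; apply/eqP; rewrite -[_ == _]negbK E.
pose j := [arg max_(j > i0) normc (v 0 j)]%O.
have jmax i : normc (v 0 i) <= normc (v 0 j).
  by rewrite /j; case: arg_maxP => // j' _ /(_ i isT).
have vj0 : 0 < normc (v 0 j).
  apply: lt_le_trans (jmax i0); rewrite lt0r normc_ge0 andbT.
  by apply: contra vi0 => /eqP/eq0_normc ->.
have : v 0 j * c%:C = - \sum_i v 0 i * (T i j - ((i == j)%:R * c)%:C).
  have /matrixP/(_ 0 j) := vT; rewrite !mxE => E.
  under eq_bigr do rewrite mulrBr.
  rewrite sumrB E sub0r opprK (bigD1 j) //= big1 ?addr0 => [|i ij].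
    by rewrite eqxx mul1r.
  by rewrite (negbTE ij) mul0r mulr0.
move=> /(congr1 (@normc R)); rewrite normc_opp normcM.
have -> : normc c%:C = c by rewrite /= expr0n addr0 sqrtr_sqr gtr0_norm.
move=> E; have : normc (v 0 j) * c <= \sum_(i < m) normc (v 0 j) * (c / (2 * m.+1%:R)).
  rewrite E; apply: le_trans (normc_sum _ _ _) _; apply: ler_sum => i _.
  by rewrite normcM ler_pM ?normc_ge0.
rewrite sumr_const card_ord -[leRHS]mulr_natr -!mulrA ler_pM2l // ler_pMr // => h.
have mp : (0 : R) < m.+1%:R by rewrite ltr0n.
suff : (2 * m.+1%:R)^-1 * m%:R < (1 : R) by rewrite ltNge h.
rewrite mulrC ltr_pdivrMr; last lra.
by rewrite -natr1; have : (0 : R) <= m%:R by []; lra.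
Qed.

(* [T] is the mean of [p^N pi]; for large [N] the weight [p^N] concentrates
   where [pi] is close to the identity. *)
Lemma bump_unitmx m (pi : K -> 'M[C]_m) (p : K -> R) (d : R) (B : R) :
  (forall i j, cap (fun x => pi x i j)) -> (forall x i j, normc (pi x i j) <= B) ->
  ap p -> (forall x, 0 <= p x <= 1) -> p one = 1 -> 0 < d < 1 ->
  (forall x, 1 - d < p x -> forall i j, normc (pi x i j - (i == j)%:R) <= (8 * m.+1%:R)^-1) ->
  exists N, \matrix_(i, j) cmean (fun x => (p x ^+ N)%:C * pi x i j) \in unitmx.
Proof.
move=> cpi Bpi app p01 p1 /andP[d0 d1] near.
have d2 : 0 < d / 2 by lra.
have [k [r [k0 Hr]]] := ap_net one app d2.
have kp : (0 : R) < k%:R by rewrite ltr0n.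
(* At every point one of the [k] translates of [p] by the net is at least [1 - d / 2], so the
   translates of [p^N] sum to at least [(1 - d / 2)^N]; the mean of each is that of [p^N]. *)
have low N : (1 - d / 2) ^+ N <= k%:R * mean (fun x => p x ^+ N).
  have apN := ap_exp G N app.
  have E i : mean (fun x => p (inv (r i) ** x) ^+ N) = mean (fun x => p x ^+ N).
    exact: (mean_translate G (inv (r i)) apN).
  have -> : k%:R * mean (fun x => p x ^+ N) = \sum_(i < k) mean (fun x => p (inv (r i) ** x) ^+ N).
    by under eq_bigr do rewrite E; rewrite sumr_const card_ord mulr_natl.
  have apt i : ap (fun x => p (inv (r i) ** x) ^+ N) by exact: (ap_translate G (inv (r i)) apN).
  rewrite -(mean_sum G _ apt) -[leLHS](mean_cst G); apply: (mean_le G).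
  - exact: ap_cst.
  - exact: ap_sum.
  move=> x; have [i /(_ (inv (r i)) one)] := Hr x.
  rewrite !(grp_mulr1 G) (grp_mulV G) p1 ler_distl => /andP[h _].
  rewrite (bigD1 i) //=; apply: le_trans (_ : p (inv (r i) ** x) ^+ N <= _).
    by rewrite lerXn2r // nnegrE; lra.
  rewrite lerDl sumr_ge0 // => j _; rewrite exprn_ge0 //.
  by have /andP[] := p01 (inv (r j) ** x).
pose eta : R := (8 * m.+1%:R)^-1.
have mp : (0 : R) < m.+1%:R by rewrite ltr0n.
have eta0 : 0 < eta by rewrite invr_gt0; lra.
have q01 : 0 <= (1 - d) / (1 - d / 2) < 1.
  apply/andP; split; first by rewrite divr_ge0; lra.
  by rewrite ltr_pdivrMr; lra.
pose B' := `|B| + 1.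
have B'0 : 0 <= B' by rewrite addr_ge0.
(* Where [p <= 1 - d] the weight is at most [(1 - d)^N]; this [N] makes it negligible against the
   mean [c] of [p^N], which is at least [(1 - d / 2)^N / k]. *)
have [N HN] := geometric_small (B' * k%:R) q01 eta0.
exists N; set c := mean (fun x => p x ^+ N) in low *.
have apN : ap (fun x => p x ^+ N) := ap_exp G N app.
have qp : 0 < (1 - d / 2) ^+ N by rewrite exprn_gt0 //; lra.
have c0 : 0 < c by have := low N; rewrite -/c => h; rewrite -(pmulr_rgt0 _ kp); lra.
have tail : B' * (1 - d) ^+ N <= eta * c.
  move: HN; rewrite expr_div_n mulrAC ler_pdivrMr // => h.
  rewrite -(ler_pM2r kp); have h2 := ler_wpM2l (ltW eta0) (low N).
  rewrite -/c in h2.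
  have -> : B' * (1 - d) ^+ N * k%:R = (1 - d) ^+ N * (B' * k%:R) by ring.
  by apply: le_trans h _; apply: le_trans h2 _; rewrite (mulrC _ c) mulrA.
have key (g : K -> R) : ap g -> (forall x, `|g x| <= B') ->
    (forall x, 1 - d < p x -> `|g x| <= eta) -> `|mean (fun x => p x ^+ N * g x)| <= 2 * eta * c.
  move=> apg gB gn.
  pose h x := eta * p x ^+ N + B' * (1 - d) ^+ N.
  have a1 : ap (fun x => eta * p x ^+ N) := apZ G eta apN.
  have a2 : ap (fun=> B' * (1 - d) ^+ N) := ap_cst _ _.
  have aph : ap h := apD a1 a2.
  have mh : mean h <= 2 * eta * c.
    by rewrite /h (meanD G a1 a2) (meanZ G _ apN) (mean_cst G) -/c; lra.
  have bd x : `|p x ^+ N * g x| <= h x.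
    have /andP[px0 px1] := p01 x; have pN : 0 <= p x ^+ N by rewrite exprn_ge0.
    rewrite normrM ger0_norm // /h; have [lt|ge] := ltP (1 - d) (p x).
      have := ler_wpM2l pN (gn x lt).
      have : 0 <= B' * (1 - d) ^+ N by rewrite mulr_ge0 // exprn_ge0 //; lra.
      lra.
    have pd : p x ^+ N <= (1 - d) ^+ N by rewrite lerXn2r // nnegrE; lra.
    have := ler_pM pN (normr_ge0 _) pd (gB x).
    have : 0 <= eta * p x ^+ N by rewrite mulr_ge0 // ltW.
    lra.
  have apf := apM G apN apg.
  rewrite ler_norml; apply/andP; split.
    apply: le_trans (_ : mean (fun x => -1 * h x) <= _).
      by rewrite (meanZ G) // mulN1r lerN2.
    apply: (mean_le G) => [||x]; rewrite ?mulN1r //; first exact: (apZ G).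
    by have := bd x; rewrite ler_norml => /andP[].
  apply: le_trans mh; apply: (mean_le G) => // x.
  by have := bd x; rewrite ler_norml => /andP[].
apply: (@near_scalar_unitmx _ _ c c0) => i j; rewrite mxE.
pose f x := pi x i j - (i == j)%:R.
have capf : cap f by apply: capD => //; exact: cap_cst.
have fB x : normc (f x) <= B'.
  apply: le_trans (normc_add _ _) _; rewrite normc_opp /B'; apply: lerD.
    exact: le_trans (Bpi x i j) (ler_norm _).
  by case: (i == j); rewrite ?normc1 ?normc0.
have capN : cap (fun x => (p x ^+ N)%:C) by split=> //=; exact: ap_cst.
have -> : cmean (fun x => (p x ^+ N)%:C * pi x i j) - ((i == j)%:R * c)%:C =
   cmean (fun x => (p x ^+ N)%:C * f x).
  have cE : cmean (fun x => (p x ^+ N)%:C) = c%:C by rewrite /cmean /= (mean_cst G).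
  have -> : ((i == j)%:R * c)%:C = (i == j)%:R * cmean (fun x => (p x ^+ N)%:C).
    by rewrite cE rmorphM rmorph_nat.
  rewrite -mulNr -cmeanZ // -cmeanD //; [| exact: capM | by apply: capM => //; exact: cap_cst].
  by apply: cmean_ext => x; rewrite /f; ring.
apply: le_trans (normc_le_ReIm _) _; rewrite /cmean /=.
have kr := key (fun x => Re (f x)) capf.1 (fun x => le_trans (le_Re_normc _) (fB x))
  (fun x lt => le_trans (le_Re_normc _) (near x lt i j)).
have ki := key (fun x => Im (f x)) capf.2 (fun x => le_trans (le_Im_normc _) (fB x))
  (fun x lt => le_trans (le_Im_normc _) (near x lt i j)).
have -> : c / (2 * m.+1%:R) = 2 * eta * c + 2 * eta * c.
  by rewrite /eta; move: (m.+1%:R) mp => M Mp; field; rewrite gt_eqF.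
have -> : (fun x => Re ((p x ^+ N)%:C * f x)) = (fun x => p x ^+ N * Re (f x)).
  by apply/funext => x; rewrite ReM /= mul0r subr0.
have -> : (fun x => Im ((p x ^+ N)%:C * f x)) = (fun x => p x ^+ N * Im (f x)).
  by apply/funext => x; rewrite ImM /= mul0r addr0.
exact: lerD.
Qed.

End ComplexMean.

(** * The group of unitary characters *)

Section UnitaryCharacters.
Local Open Scope complex_scope.
Local Open Scope sesquilinear_scope.
Variables (R : realType).
Local Notation C := R[i].
Variables (A : algType C) (Irr : eqType) (n : Irr -> nat).
Variable (u : forall s, 'M[A]_(n s)).
Variable star : A -> A.
Hypothesis H : cqg_algebra u star.
Local Notation fn := (fn H).
Local Notation Lop := (Lop H).
Local Notation chr := (chr H).
Local Notation K := (Gtilde u).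
Local Notation Xm x := (Xphi u (sval x)).

Lemma is_char_chr phi : is_char phi -> phi = fn (Xphi u phi) /\ chr (Xphi u phi).
Proof.
move=> [lin mlt [a pa]]; have E := lin_fun_fn H lin; split=> //.
split=> [b c|]; rewrite -E; first exact: mlt.
have := mlt 1 a; rewrite mul1r => /eqP; rewrite -[X in X == _]mul1r => h.
by apply: (mulIf pa); apply/esym/eqP.
Qed.

Lemma chr_is_char X : chr X -> is_char (fn X).
Proof.
move=> [XM X1]; split=> //; first exact: linearP.
by exists 1; rewrite X1 oner_neq0.
Qed.

Lemma Xphi_fn X s : Xphi u (fn X) s = X s.
Proof. by apply/matrixP => i j; rewrite mxE fnE. Qed.

Lemma unitary_in_VN X : (forall s, X s \is unitarymx) -> in_VN u (fn X).
Proof. by move=> uX; exists 1 => s; rewrite Xphi_fn; apply: unitary_opnorm. Qed.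

Definition mkG X (cX : chr X) (uX : forall s, X s \is unitarymx) : K :=
  exist _ (fn X : A -> C) (conj (chr_is_char cX) (unitary_in_VN uX)).

Lemma G_chr (x : K) : chr (Xm x).
Proof. by case: x => phi [p q] /=; have [] := is_char_chr p. Qed.

Lemma GE (x : K) a : sval x a = fn (Xm x) a.
Proof. by case: x => phi [p q] /=; have [<-] := is_char_chr p. Qed.

Lemma G_unitary (x : K) s : Xm x s \is unitarymx.
Proof.
have cx := G_chr x; move: cx; case: x => phi [ph [M bd]] /= cx.
exact: (bounded_unitary cx bd).
Qed.

Lemma G_eq (x y : K) : (forall s, Xm x s = Xm y s) -> x = y.
Proof.
move=> E; have : sval x = sval y.
  by apply/funext => a; rewrite !GE; apply: eq_fn.
case: x {E} => f p; case: y => g q /= E; subst g.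
by congr exist; apply: Prop_irrelevance.
Qed.

Lemma mulG_unitary (x y : K) s : famM (Xm x) (Xm y) s \is unitarymx.
Proof. by apply: mul_unitarymx; apply: G_unitary. Qed.
Lemma invG_unitary (x : K) s : famV (Xm x) s \is unitarymx.
Proof. by rewrite /famV invmx_unitary ?trmxC_unitary G_unitary. Qed.
Lemma oneG_unitary s : fam1 R n s \is unitarymx.
Proof. by apply/unitarymxP; rewrite trmx1 map_mx1 mulmx1. Qed.

Definition mulG (x y : K) : K := mkG (chrM (G_chr x) (G_chr y)) (mulG_unitary x y).
Definition invG (x : K) : K := mkG (chrV (G_chr x)) (invG_unitary x).
Definition oneG : K := mkG (chr1 H) oneG_unitary.

Lemma Xm_mul x y s : Xm (mulG x y) s = Xm x s *m Xm y s. Proof. exact: Xphi_fn. Qed.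
Lemma Xm_inv x s : Xm (invG x) s = invmx (Xm x s). Proof. exact: Xphi_fn. Qed.
Lemma Xm_one s : Xm oneG s = 1%:M. Proof. exact: Xphi_fn. Qed.

Lemma G_is_group : is_group mulG oneG invG.
Proof.
split=> [x y z|x|x|x|x]; apply: G_eq => s; rewrite !(Xm_mul, Xm_inv, Xm_one).
- exact: mulmxA.
- exact: mul1mx.
- exact: mulmx1.
- by rewrite mulVmx // unitarymx_unit // G_unitary.
- by rewrite mulmxV // unitarymx_unit // G_unitary.
Qed.

Lemma is_conv_mulG x y : is_conv u (sval x) (sval y) (sval (mulG x y)).
Proof.
move=> s i j; rewrite -[LHS](mxE matrix_key (fun i j => _ (u s i j))).
rewrite -[LHS]/(Xm (mulG x y) s i j) Xm_mul mxE.
by apply: eq_bigr => k _; rewrite !mxE.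
Qed.

(** The Gelfand transform of [a] on [Gtilde]. *)
Definition hat (a : A) (x : K) : C := sval x a.

Arguments hat : simpl never.

Lemma hatM a b x : hat (a * b) x = hat a x * hat b x.
Proof. by rewrite /hat !GE; have [-> _] := G_chr x. Qed.
Lemma hat1 x : hat 1 x = 1.
Proof. by rewrite /hat GE; have [_ ->] := G_chr x. Qed.
Lemma hat_lin k a b x : hat (k *: a + b) x = k * hat a x + hat b x.
Proof. by rewrite /hat !GE linearP. Qed.
Lemma hat0 x : hat 0 x = 0.
Proof. by rewrite /hat GE linear0. Qed.
Lemma hatD a b x : hat (a + b) x = hat a x + hat b x.
Proof. by rewrite -[a]scale1r hat_lin scale1r mul1r. Qed.
Lemma hatZ k a x : hat (k *: a) x = k * hat a x.
Proof. by rewrite -[k *: a]addr0 hat_lin hat0 addr0. Qed.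
Lemma hat_sum (I : Type) (l : seq I) (F : I -> A) x :
  hat (\sum_(i <- l) F i) x = \sum_(i <- l) hat (F i) x.
Proof.
elim: l => [|i l IH]; first by rewrite !big_nil hat0.
by rewrite !big_cons hatD IH.
Qed.
Lemma hatX a k x : hat (a ^+ k) x = hat a x ^+ k.
Proof. by elim: k => [|k IH]; rewrite ?expr0 ?hat1 // !exprS hatM IH. Qed.

Lemma hat_u s i j x : hat (u s i j) x = Xm x s i j. Proof. by rewrite mxE. Qed.

Lemma hat_star_u s i j x : hat (star (u s i j)) x = (Xm x s i j)^*%R.
Proof.
have := famstar_invmx s (G_chr x); rewrite invmx_unitary ?G_unitary // => /matrixP/(_ j i).
by rewrite !mxE /hat [sval x (star _)]GE => ->.
Qed.

Lemma hat_star a x : hat (star a) x = (hat a x)^*%R.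
Proof.
have E : (fun a => (hat (star a) x)^*%R) =1 (fun a => hat a x).
  apply: (linear_ext H).
  - by move=> k b c; rewrite (star_antilin H) hat_lin rmorphD rmorphM /= conjCK.
  - by move=> k b c; rewrite hat_lin.
  - by move=> s i j; rewrite hat_star_u conjCK hat_u.
by rewrite -(E a) conjCK.
Qed.

Lemma hat_inv s i j x : Xm (invG x) s i j = hat (star (u s j i)) x.
Proof. by rewrite Xm_inv invmx_unitary ?G_unitary // hat_star_u !mxE. Qed.

Lemma char_dense phi a : is_char phi -> (forall x : K, hat a x = 0) -> phi a = 0.
Proof.
move=> /is_char_chr[E cphi] a0; rewrite E.
by apply: (chr_unitary_dense cphi) => U cU uU; apply: (a0 (mkG cU uU)).
Qed.

Lemma char_eq phi a b : is_char phi -> (forall x : K, hat a x = hat b x) -> phi a = phi b.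
Proof.
move=> cp E; have [lin _ _] := cp.
have : phi (-1 *: b + a) = 0.
  by apply: char_dense => // x; rewrite hat_lin E mulN1r addNr.
by rewrite lin mulN1r addrC => /eqP; rewrite subr_eq0 => /eqP.
Qed.

(** [b] is the left convolution [(fn X (x) id) (Delta a)], the mirror image of [Lop]. *)
Lemma left_translate X a : exists b, forall Y, fn Y b = fn (famM X Y) a.
Proof.
pose L : {linear A -> A} := lext H (fun t : idx n =>
  \sum_k X (tag t) (tagged t).1 k *: u (tag t) k (tagged t).2).
exists (L a) => Y; apply: (linear_ext H (f := fn Y \o L)); try exact: linearP.
move=> s i j /=; rewrite [L _](lextE H _ (tg i j)) linear_sum fnE mxE.
by apply: eq_bigr => k _; rewrite linearZ /= fnE.
Qed.

(** Entry [(i, j)] of [g^-1 x] is [\sum_k (g^-1)_ik x_kj], and by unitarity [(g^-1)_ik] is the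
    transform of [star (u s k i)] at [g]. *)
Lemma hat_coproduct b : exists l : seq (A * A),
  forall g x, hat b (mulG (invG g) x) = \sum_(p <- l) hat p.1 g * hat p.2 x.
Proof.
have [l [c ->]] := basis_span H b.
elim: l => [|[s [i j]] l [l' IH]].
  by exists [::] => g x; rewrite !big_nil hat0.
exists ([seq (c (Tagged _ (i, j)) *: star (u s k i), u s k j) | k <- enum 'I_(n s)] ++ l').
move=> g x; rewrite big_cons hat_lin IH big_cat big_map /=; congr (_ + _).
rewrite -[Defs.ub u _]/(u s i j) hat_u Xm_mul mxE mulr_sumr big_enum /=; apply: eq_bigr => k _.
by rewrite hatZ hat_inv hat_u mulrA.
Qed.

Local Notation cap := (@cap R K mulG).
Local Notation cmean := (@cmean R K mulG).

Lemma G_entry (x : K) s i j : normc (Xm x s i j) <= 1.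
Proof. by rewrite -lecR -normr_normc; apply: unitary_entry; apply: G_unitary. Qed.

Lemma cap_hat a : cap (hat a).
Proof.
have [l [c ->]] := basis_span H a.
apply: (@cap_ext _ _ _ (fun x => \sum_(t <- l) c t * hat (Defs.ub u t) x)); last first.
  by move=> x; rewrite hat_sum; apply: eq_bigr => t _; rewrite hatZ.
apply: cap_sum => -[s [i j]]; apply: (capM G_is_group); first exact: cap_cst.
apply: (@cap_ext _ _ _ (fun x => Xm x s i j)); last by move=> x; rewrite -hat_u.
apply: (@cap_rep _ _ _ oneG _ (fun x => Xm x s) 1) => [x y|x k q]; first exact: Xm_mul.
exact: G_entry.
Qed.

End UnitaryCharacters.

(** * The weak-star topology *)

Section UnorderedSums.
Local Open Scope complex_scope.
Local Open Scope sesquilinear_scope.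
Variables (R : realType) (T : eqType).
Local Notation C := R[i].
Implicit Types (g r : T -> R) (l : seq T).

Definition bounded_sums r := exists B : R, forall l, uniq l -> \sum_(s <- l) r s <= B.

Lemma sum_subset (V : zmodType) (F : T -> V) l0 l : uniq l0 -> uniq l -> {subset l0 <= l} ->
  \sum_(s <- l) F s = \sum_(s <- l0) F s + \sum_(s <- l | s \notin l0) F s.
Proof.
move=> u0 ul sub; rewrite (bigID (mem l0)) /=; congr (_ + _).
rewrite -[LHS]big_filter; apply: perm_big; apply: uniq_perm => //.
  exact: filter_uniq.
by move=> t; rewrite mem_filter; apply/andP/idP => [[]//|tl]; split=> //; apply: sub.
Qed.

(** The sum over [l0] is within [e] of the supremum of all finite sums, so a longer list cannot add
    more than [e]. *)
Lemma bounded_sums_tail r e : (forall s, 0 <= r s) -> bounded_sums r -> 0 < e ->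
  exists2 l0, uniq l0 & forall l, uniq l -> {subset l0 <= l} ->
    \sum_(s <- l | s \notin l0) r s <= e.
Proof.
move=> r0 [B HB] e0; pose S := [set t : R | exists2 l, uniq l & t = \sum_(s <- l) r s].
have hS : has_sup S.
  by split; [exists 0, [::]; rewrite ?big_nil | exists B => _ [l ul ->]; apply: HB].
have [_ [l0 u0 ->] h] := sup_adherent e0 hS.
exists l0 => // l ul sub.
have : \sum_(s <- l) r s <= sup S by apply: sup_upper_bound => //; exists l.
by rewrite (sum_subset _ u0 ul sub); lra.
Qed.

Definition real_has_sum g (v : R) := forall e : R, 0 < e -> exists l0,
  forall l, uniq l -> {subset l0 <= l} -> `|\sum_(s <- l) g s - v| <= e.

Lemma real_has_sum_ge0 r : (forall s, 0 <= r s) -> bounded_sums r -> exists v, real_has_sum r v.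
Proof.
move=> r0 [B HB]; pose S := [set t : R | exists2 l, uniq l & t = \sum_(s <- l) r s].
have hS : has_sup S.
  by split; [exists 0, [::]; rewrite ?big_nil | exists B => _ [l ul ->]; apply: HB].
exists (sup S) => e e0; have [_ [l0 u0 ->] h] := sup_adherent e0 hS.
exists l0 => l ul sub.
have h1 : \sum_(s <- l) r s <= sup S by apply: sup_upper_bound => //; exists l.
have h2 : \sum_(s <- l0) r s <= \sum_(s <- l) r s.
  by rewrite (sum_subset _ u0 ul sub) lerDl sumr_ge0.
by rewrite ler_distl; apply/andP; split; lra.
Qed.

(** [g] is the difference of the nonnegative summable families [g + r] and [r]. *)
Lemma real_has_sum_dominated g r : (forall s, `|g s| <= r s) -> bounded_sums r ->
  exists v, real_has_sum g v.
Proof.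
move=> gr [B HB]; have r0 s : 0 <= r s by apply: le_trans (gr s).
have [v Hv] := real_has_sum_ge0 r0 (ex_intro _ B HB).
have [w Hw] : exists w, real_has_sum (fun s => g s + r s) w.
  apply: real_has_sum_ge0 => [s|]; first by have := gr s; rewrite ler_norml => /andP[]; lra.
  exists (B + B) => l ul; rewrite big_split /=; apply: lerD; last exact: HB.
  by apply: le_trans (HB l ul); apply: ler_sum => s _; apply: le_trans (gr s); apply: ler_norm.
exists (w - v) => e e0; have e2 : 0 < e / 2 by lra.
have [l1 H1] := Hv _ e2; have [l2 H2] := Hw _ e2.
exists (l1 ++ l2) => l ul sub.
have h1 : `|\sum_(s <- l) r s - v| <= e / 2.
  by apply: H1 => // s sl; apply: sub; rewrite mem_cat sl.
have h2 : `|\sum_(s <- l) (g s + r s) - w| <= e / 2.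
  by apply: H2 => // s sl; apply: sub; rewrite mem_cat sl orbT.
move: h1 h2; rewrite big_split /= !ler_distl => /andP[a1 a2] /andP[b1 b2].
by apply/andP; split; lra.
Qed.

Lemma has_sum_dominated (g : T -> C) r : (forall s, normc (g s) <= r s) -> bounded_sums r ->
  exists v, has_sum g v.
Proof.
move=> gr br.
have [a Ha] := real_has_sum_dominated (fun s => le_trans (le_Re_normc (g s)) (gr s)) br.
have [b Hb] := real_has_sum_dominated (fun s => le_trans (le_Im_normc (g s)) (gr s)) br.
have ReS l : complex.Re (\sum_(s <- l) g s) = \sum_(s <- l) complex.Re (g s).
  by elim: l => [|s l IH]; rewrite ?big_nil // !big_cons ReD IH.
have ImS l : complex.Im (\sum_(s <- l) g s) = \sum_(s <- l) complex.Im (g s).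
  by elim: l => [|s l IH]; rewrite ?big_nil // !big_cons ImD IH.
exists (Complex a b) => e e0; have e3 : 0 < e / 3 by lra.
have [l1 H1] := Ha _ e3; have [l2 H2] := Hb _ e3.
exists (l1 ++ l2) => l ul sub; rewrite normr_normc ltcR.
apply: le_lt_trans (normc_le_ReIm _) _; rewrite ReD ImD ReN ImN ReS ImS /=.
have h1 : `|\sum_(s <- l) complex.Re (g s) - a| <= e / 3.
  by apply: H1 => // s sl; apply: sub; rewrite mem_cat sl.
have h2 : `|\sum_(s <- l) complex.Im (g s) - b| <= e / 3.
  by apply: H2 => // s sl; apply: sub; rewrite mem_cat sl orbT.
lra.
Qed.

End UnorderedSums.

(** * Weak-star neighbourhoods of the unit in terms of finitely many matrix entries *)

Section WeakStar.
Local Open Scope complex_scope.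
Local Open Scope sesquilinear_scope.
Variables (R : realType).
Local Notation C := R[i].
Variables (A : algType C) (Irr : eqType) (n : Irr -> nat).
Variable (u : forall s, 'M[A]_(n s)).
Variable star : A -> A.
Hypothesis H : cqg_algebra u star.
Local Notation K := (Gtilde u).
Local Notation Xm x := (Xphi u (sval x)).
Local Notation oneG := (oneG H).

Lemma epairB m (Om X Y : 'M[C]_m) : epair Om (X - Y) = epair Om X - epair Om Y.
Proof.
rewrite /epair -sumrB; apply: eq_bigr => i _; rewrite -sumrB; apply: eq_bigr => j _.
by rewrite !mxE mulrBr.
Qed.

Lemma epair_delta m (X : 'M[C]_m) c i j : epair (c *: delta_mx i j) X = c * X i j.
Proof.
rewrite /epair (bigD1 i) //= [X in _ + X]big1 ?addr0 => [|i' ii].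
  rewrite (bigD1 j) //= [X in _ + X]big1 ?addr0 => [|j' jj].
    by rewrite !mxE !eqxx mulr1.
  by rewrite !mxE (negbTE jj) andbF mulr0 mul0r.
by rewrite big1 // => j' _; rewrite !mxE (negbTE ii) mulr0 mul0r.
Qed.

Lemma opnorm_entry m (X : 'M[C]_m) i j : opnorm_le X 1 -> `|X i j| <= 1.
Proof.
move=> /(_ (delta_mx j 0) (delta_mx i 0)).
have D k : \sum_(i < m) `|(delta_mx k 0 : 'cV[C]_m) i 0| ^+ 2 = 1.
  rewrite (bigD1 k) //= mxE !eqxx normr1 expr1n big1 ?addr0 // => l lk.
  by rewrite mxE (negbTE lk) normr0 expr0n.
rewrite !D expr1n !mulr1 expr_le1 //; congr (`|_| <= _).
rewrite (bigD1 i) //= [X in _ + X]big1 ?addr0 => [|k ki].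
  rewrite (bigD1 j) //= [X in _ + X]big1 ?addr0 => [|k kj].
    by rewrite !mxE !eqxx rmorph1 mulr1 mul1r.
  by rewrite [delta_mx j 0 _ _]mxE (negbTE kj) mulr0.
by rewrite big1 // => l _; rewrite mxE (negbTE ki) rmorph0 !mul0r.
Qed.

(** The matrix unit [(i, j)] in component [s] and zero in the others; comparing tagged indices
    avoids transporting matrices along [t = s]. *)
Definition coef_predual s (i j : 'I_(n s)) : forall t, 'M[C]_(n t) :=
  fun t => \matrix_(p, q) (tg p q == tg i j)%:R.

Lemma coef_predual_same s (i j : 'I_(n s)) X : epair (coef_predual i j s) X = X i j.
Proof.
rewrite -[RHS]mul1r -epair_delta scale1r; congr epair; apply/matrixP => p q.
by rewrite !mxE /tg eq_Tagged.
Qed.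

Lemma coef_predual_diff s t (i j : 'I_(n s)) X : t != s -> epair (coef_predual i j t) X = 0.
Proof.
move=> ts; rewrite /epair big1 // => p _; rewrite big1 // => q _; rewrite mxE.
case: eqP => [/(congr1 tag)/= /eqP E|_]; last exact: mul0r.
by rewrite E in ts.
Qed.

Lemma coef_in_predual s (i j : 'I_(n s)) : in_predual (coef_predual i j).
Proof.
exists (fun t => (t == s)%:R); split=> [t X opX|].
  have [E|ts] := eqVneq t s; last by rewrite coef_predual_diff // normr0.
  by subst t; rewrite coef_predual_same; apply: opnorm_entry.
exists 1 => l ul; have [sl|sl] := boolP (s \in l).
  by rewrite (bigD1_seq s) //= eqxx big1 ?addr0 // => t /negbTE ->.
rewrite big_seq big1 ?ler01 // => t tl; case: eqP => // E.
by rewrite -E tl in sl.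
Qed.

Lemma wstar_cont_coef s i j : wstar_cont (fun x : K => Xm x s i j).
Proof.
move=> x0 eps e0; exists 1%N, (fun=> coef_predual i j), (eps / 2).
split=> [||x]; first lra; first by move=> _; apply: coef_in_predual.
move=> /(_ ord0)[v [hv vd]].
have [l0 Hl] := hv (eps / 2) ltac:(lra).
(* Adjoining [s] to the list reduces the sum to the single entry at [s]. *)
have sub : {subset l0 <= undup (s :: l0)}.
  by move=> t tl; rewrite mem_undup inE tl orbT.
have {Hl} := Hl (undup (s :: l0)) (undup_uniq _) sub.
rewrite (bigD1_seq s) ?undup_uniq ?mem_undup ?mem_head //= big1; last first.
  by move=> t ts; rewrite coef_predual_diff.
rewrite addr0 coef_predual_same => h.
have -> : Xm x s i j - Xm x0 s i j = ((Xm x s - Xm x0 s) i j - v) + v.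
  by rewrite subrK !mxE.
apply: le_lt_trans (ler_normD _ _) _; apply: lt_le_trans (ltrD h vd) _.
by rewrite -rmorphD lecR; lra.
Qed.

Lemma cont_rep_u s : cont_rep (fun x : K => Xm x s).
Proof.
split=> [x y z E|e E|i j]; last exact: wstar_cont_coef.
  by apply/matrixP => i j; rewrite !mxE E; apply: eq_bigr => k _; rewrite !mxE.
by apply/matrixP => i j; rewrite !mxE E.
Qed.

Lemma PolGt_hat a : PolGt (hat (u := u) a).
Proof.
have [l [c ->]] := basis_span H a.
pose t (k : 'I_(size l)) := tnth (in_tuple l) k.
exists (size l), (fun k => n (tag (t k))), (fun k x => Xm x (tag (t k))),
  (fun k => c (t k) *: delta_mx (tagged (t k)).1 (tagged (t k)).2).
split=> [k|]; first exact: cont_rep_u.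
apply/funext => x; rewrite (hat_sum H) big_tnth; apply: eq_bigr => k _.
by rewrite (hatZ H) epair_delta mxE.
Qed.

(** Unitary matrices pair with [Om s] to at most [r s], so indices outside [l1] contribute at most
    [2 * (d / 8)]. Closeness of entries on [l1] costs at most [d / 4], and so does replacing [v] by
    a finite sum. *)
Lemma predual_small (Om : forall s, 'M[C]_(n s)) (d : R) : in_predual Om -> 0 < d ->
  exists (l : seq Irr) (e : R), 0 < e /\ forall x : K,
    (forall s, s \in l -> forall i j, normc (Xm x s i j - (i == j)%:R) <= e) ->
    exists v, has_sum (fun s => epair (Om s) (Xm x s - Xm oneG s)) v /\ `|v| < d%:C.
Proof.
move=> [r [Hr br]] d0.
have rx (x : K) s : normc (epair (Om s) (Xm x s)) <= r s.
  by rewrite -lecR -normr_normc; apply/Hr/unitary_opnorm/(G_unitary H).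
have r0 s : 0 <= r s by apply: le_trans (rx oneG s); apply: normc_ge0.
have d8 : 0 < d / 8 by lra.
have [l1 u1 tail] := bounded_sums_tail r0 br d8.
pose W := \sum_(s <- l1) \sum_i \sum_j normc (Om s i j).
have W0 : 0 <= W by apply: sumr_ge0 => s _; apply: sumr_ge0 => i _; apply: sumr_ge0 => j _; apply: normc_ge0.
exists l1, (d / 4 / (W + 1)); split; first by rewrite divr_gt0; lra.
move=> x near; pose g s := epair (Om s) (Xm x s - Xm oneG s); rewrite -/g.
have gr s : normc (g s) <= 2 * r s.
  rewrite /g epairB; apply: le_trans (normc_add _ _) _; rewrite normc_opp.
  by have := rx x s; have := rx oneG s; lra.
have br2 : bounded_sums (fun s => 2 * r s).
  by case: br => B HB; exists (2 * B) => l ul; rewrite -mulr_sumr ler_pM2l // HB.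
have [v hv] := has_sum_dominated gr br2; exists v; split=> //.
have [l0 Hl] := hv (d / 4) ltac:(lra).
pose l := undup (l1 ++ l0).
have ul : uniq l := undup_uniq _.
have s0 : {subset l0 <= l} by move=> t tl; rewrite mem_undup mem_cat tl orbT.
have s1 : {subset l1 <= l} by move=> t tl; rewrite mem_undup mem_cat tl.
have := Hl l ul s0; rewrite !normr_normc !ltcR => hl.
have -> : v = \sum_(s <- l) g s - (\sum_(s <- l) g s - v) by rewrite opprB addrC subrK.
apply: le_lt_trans (normc_add _ _) _; rewrite normc_opp.
suff : normc (\sum_(s <- l) g s) <= d / 4 + 2 * (d / 8) by move: hl; lra.
rewrite (sum_subset _ u1 ul s1); apply: le_trans (normc_add _ _) (lerD _ _).
  apply: le_trans (normc_sum _ _ _) _.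
  apply: le_trans (_ : W * (d / 4 / (W + 1)) <= _); last first.
    by rewrite mulrCA -[leRHS]mulr1 ler_pM2l ?ler_pdivrMr; lra.
  rewrite /W mulr_suml big_seq [leRHS]big_seq; apply: ler_sum => s sl.
  rewrite /g /epair mulr_suml; apply: le_trans (normc_sum _ _ _) _.
  apply: ler_sum => i _; rewrite mulr_suml; apply: le_trans (normc_sum _ _ _) _.
  apply: ler_sum => j _; rewrite normcM ler_wpM2l ?normc_ge0 //.
  by have := near s sl i j; rewrite Xm_one !mxE.
apply: le_trans (normc_sum _ _ _) _.
apply: le_trans (_ : \sum_(s <- l | s \notin l1) 2 * r s <= _); first exact: ler_sum.
by rewrite -mulr_sumr ler_pM2l // tail.
Qed.

Lemma near_family (I : finType) (P : I -> K -> Prop) :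
  (forall k, exists (l : seq Irr) (e : R), 0 < e /\ forall x : K,
    (forall s, s \in l -> forall i j, normc (Xm x s i j - (i == j)%:R) <= e) -> P k x) ->
  exists (l : seq Irr) (e : R), 0 < e /\ forall x : K,
    (forall s, s \in l -> forall i j, normc (Xm x s i j - (i == j)%:R) <= e) -> forall k, P k x.
Proof.
move=> /choice[l /choice[e Hle]].
(* The second witness is a positive lower bound of all [e k], even for empty [I]. *)
exists (flatten [seq l k | k <- enum I]), (1 + \sum_k (e k)^-1)^-1.
have e0 k : 0 < (e k)^-1 by rewrite invr_gt0; case: (Hle k).
have s0 : 0 < 1 + \sum_k (e k)^-1 by rewrite ltr_wpDr // sumr_ge0 // => k _; apply: ltW.
split=> [|x near k]; first by rewrite invr_gt0.
have [ek Hk] := Hle k; apply: Hk => s sl i j; apply: le_trans (near s _ i j) _.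
  by apply/flatten_mapP; exists k; rewrite ?mem_enum.
rewrite -[leRHS]invrK lef_pV2 ?posrE //.
by rewrite (bigD1 k) //= addrCA lerDl addr_ge0 // sumr_ge0 // => j' _; apply: ltW.
Qed.

Lemma wstar_near (h : K -> C) (eps : R) : wstar_cont h -> 0 < eps ->
  exists (l : seq Irr) (e : R), 0 < e /\ forall x : K,
    (forall s, s \in l -> forall i j, normc (Xm x s i j - (i == j)%:R) <= e) ->
    normc (h x - h oneG) <= eps.
Proof.
move=> hc eps0; have [N [Oms [d [d0 pre Hx]]]] := hc oneG eps eps0.
have [l [e [e0 Hle]]] := near_family (fun k => predual_small (pre k) d0).
exists l, e; split=> // x /Hle near.
by have := Hx x near; rewrite normr_normc ltcR => /ltW.
Qed.

End WeakStar.

(** * Surjectivity onto Pol(Gtilde) *)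

Section Surjectivity.
Local Open Scope complex_scope.
Local Open Scope sesquilinear_scope.
Variables (R : realType).
Local Notation C := R[i].
Variables (A : algType C) (Irr : eqType) (n : Irr -> nat).
Variable (u : forall s, 'M[A]_(n s)).
Variable star : A -> A.
Hypothesis H : cqg_algebra u star.
Local Notation K := (Gtilde u).
Local Notation Xm x := (Xphi u (sval x)).
Local Notation mulG := (mulG H).
Local Notation invG := (invG H).
Local Notation oneG := (oneG H).
Local Notation GG := (G_is_group H).
Local Notation cap := (@cap R K mulG).
Local Notation cmean := (@cmean R K mulG).

(* [hat b x = 1 - c * sum |X_s(x)_ij - delta_ij|^2], the sum over [s] in a finite list. *)
Lemma bump_exists (l : seq Irr) (e : R) : 0 < e ->
  exists (b : A) (p : K -> R) (d : R),
    [/\ forall x, hat b x = (p x)%:C, forall x, 0 <= p x <= 1, p oneG = 1, 0 < d < 1 &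
      forall x, 1 - d < p x -> forall s, s \in l -> forall i j,
        normc (Xm x s i j - (i == j)%:R) <= e].
Proof.
move=> e0.
pose Q (x : K) : R := \sum_(s <- l) \sum_i \sum_j normc (Xm x s i j - (i == j)%:R) ^+ 2.
pose w s i j : A := (- (i == j)%:R) *: 1 + u s i j.
pose q : A := \sum_(s <- l) \sum_i \sum_j w s i j * star (w s i j).
have hw s i j (x : K) : hat (w s i j) x = Xm x s i j - (i == j)%:R.
  by rewrite /w (hat_lin H) (hat1 H) hat_u mulr1 addrC.
have hq (x : K) : hat q x = (Q x)%:C.
  rewrite /q /Q (hat_sum H) rmorph_sum; apply: eq_bigr => s _.
  rewrite (hat_sum H) rmorph_sum; apply: eq_bigr => i _.
  rewrite (hat_sum H) rmorph_sum; apply: eq_bigr => j _.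
  by rewrite (hatM H) (hat_star H) hw -normCK normr_normc rmorphXn.
have Q0 x : 0 <= Q x.
  by apply: sumr_ge0 => s _; apply: sumr_ge0 => i _; apply: sumr_ge0 => j _; apply: sqr_ge0.
(* Entries of a unitary matrix have modulus at most [1], so each squared difference is at most [4];
   the scaling by [(B + 1)^-1] then keeps [p] in [[0, 1]]. *)
pose B : R := \sum_(s <- l) \sum_(i < n s) \sum_(j < n s) 4.
have QB x : Q x <= B.
  apply: ler_sum => s _; apply: ler_sum => i _; apply: ler_sum => j _.
  have -> : (4 : R) = 2 ^+ 2 by ring.
  rewrite lerXn2r ?nnegrE ?normc_ge0 //.
  apply: le_trans (normc_add _ _) _; rewrite normc_opp.
  have -> : (2 : R) = 1 + 1 by ring.
  by apply: lerD; [exact: (G_entry H)|case: (i == j); rewrite ?normc1 ?normc0].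
have B0 : 0 <= B by apply: le_trans (Q0 oneG) (QB oneG).
have B1 : 0 < B + 1 by lra.
pose p x := 1 - (B + 1)^-1 * Q x.
(* [p x > 1 - d] forces [Q x < e ^+ 2]; the minimum with [1 / 2] keeps [d < 1]. *)
exists (1 - (B + 1)^-1%:C *: q), p, (Num.min (e ^+ 2 / (B + 1)) (1 / 2)).
have Vp : 0 < (B + 1)^-1 by rewrite invr_gt0.
split=> [x|x|||x].
- rewrite -scaleNr addrC (hat_lin H) (hat1 H) hq /p rmorphB rmorphM rmorph1 /=.
  by rewrite mulNr addrC.
- rewrite /p; apply/andP; split; last by rewrite gerBl mulr_ge0 // ltW.
  by rewrite subr_ge0 mulrC ler_pdivrMr // mul1r; have := QB x; lra.
- rewrite /p (_ : Q oneG = 0) ?mulr0 ?subr0 // /Q big1 // => s _.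
  rewrite big1 // => i _; rewrite big1 // => j _.
  by rewrite Xm_one mxE subrr normc0 expr0n.
- by rewrite lt_min gt_min divr_gt0 ?exprn_gt0 //= !divr_gt0 //; apply/orP; right; lra.
rewrite /p ltrD2l ltrN2 lt_min mulrC ltr_pM2r // => /andP[Qe _] s sl i j.
rewrite -(@ler_sqr _ _ e) ?nnegrE ?normc_ge0 ?(ltW e0) //.
apply: le_trans (ltW Qe); rewrite /Q (big_rem s sl) /= (bigD1 i) //= (bigD1 j) //=.
rewrite -!addrA lerDl !addr_ge0 // ?sumr_ge0 // => k _; rewrite ?sqr_ge0 //.
  by rewrite sumr_ge0 // => k' _; rewrite sqr_ge0.
by rewrite sumr_ge0 // => k' _; rewrite sumr_ge0 // => k'' _; rewrite sqr_ge0.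
Qed.

Section Representation.
Variables (m : nat) (pi : K -> 'M[C]_m).
Hypothesis cpi : cont_rep pi.

Lemma cont_repM x y : pi (mulG x y) = pi x *m pi y.
Proof. by have [+ _ _] := cpi; apply; apply: is_conv_mulG. Qed.

Lemma cont_rep1 : pi oneG = 1%:M.
Proof.
have [_ + _] := cpi; apply=> s i j.
by rewrite -[LHS]/(hat (u s i j) oneG) hat_u Xm_one mxE.
Qed.

(** By weak-star continuity at the unit, [pi x] is near the identity once finitely many components
    of [x] are, and [bump_exists] detects the latter. *)
Lemma cont_rep_bump (eta : R) : 0 < eta ->
  exists (b : A) (p : K -> R) (d : R),
    [/\ forall x, hat b x = (p x)%:C, forall x, 0 <= p x <= 1, p oneG = 1, 0 < d < 1 &
      forall x, 1 - d < p x -> forall i j, normc (pi x i j - (i == j)%:R) <= eta].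
Proof.
move=> eta0; have [_ _ cont] := cpi.
have [l [e [e0 Hle]]] := near_family (fun t : 'I_m * 'I_m => wstar_near H (cont t.1 t.2) eta0).
have [b [p [d [h1 h2 h3 h4 h5]]]] := bump_exists l e0.
exists b, p, d; split=> // x px i j; have := Hle x (h5 x px) (i, j).
by rewrite /= cont_rep1 mxE.
Qed.

Lemma ap_hat_real b p : (forall x, hat b x = (p x)%:C) -> almost_periodic mulG p.
Proof.
move=> E; have [rb _] := cap_hat H b.
by apply: ap_ext rb _ => x; rewrite E.
Qed.

(* Finitely many translates of the neighbourhood of the unit where [pi] is
   within [1] of the identity cover the group. *)
Lemma cont_rep_bounded : exists B : R, forall x i j, normc (pi x i j) <= B.
Proof.
have [b [p [d [h1 h2 h3 /andP[d0 d1] h5]]]] := cont_rep_bump ltr01.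
have d2 : 0 < d / 2 by lra.
have [k [r [k0 Hr]]] := ap_net oneG (ap_hat_real h1) d2.
exists (\sum_a \sum_i \sum_j normc (pi (r a) i j) * 2) => x i j.
have [a /(_ (invG (r a)) oneG)] := Hr x.
rewrite !(grp_mulr1 GG) (grp_mulV GG) h3 ler_distl => /andP[h _].
have near := h5 (mulG (invG (r a)) x) ltac:(lra).
have -> : pi x = pi (r a) *m pi (mulG (invG (r a)) x).
  by rewrite -cont_repM (grp_mulA GG) (grp_mulrV GG) (grp_mul1 GG).
rewrite mxE; apply: le_trans (normc_sum _ _ _) _.
apply: le_trans (_ : \sum_q normc (pi (r a) i q) * 2 <= _).
  apply: ler_sum => q _; rewrite normcM ler_wpM2l ?normc_ge0 //.
  rewrite -[X in normc X](subrK ((q == j)%:R)); apply: le_trans (normc_add _ _) _.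
  have := near q j; have : normc ((q == j)%:R : C) <= 1.
    by case: (q == j); rewrite ?normc1 ?normc0.
  lra.
have nn c i' j' : 0 <= normc (pi (r c) i' j') * 2 by rewrite mulr_ge0 ?normc_ge0.
rewrite [leRHS](bigD1 a) //= [X in _ <= X + _](bigD1 i) //= -addrA lerDl addr_ge0 //.
  by apply: sumr_ge0 => i' _; apply: sumr_ge0 => j' _; apply: nn.
by apply: sumr_ge0 => c _; apply: sumr_ge0 => i' _; apply: sumr_ge0 => j' _; apply: nn.
Qed.

(* [pi g *m T], for [T] the mean of [p^N pi], equals the mean of
   [x |-> p^N (g^-1 x) pi x]; expanding [p^N (g^-1 x)] by the coproduct shows
   that its entries are in the image of [A]. *)
Lemma cont_rep_hat i j : exists a : A, (fun x => pi x i j) = hat a.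
Proof.
have [B HB] := cont_rep_bounded.
have capi k l : cap (fun x => pi x k l) := cap_rep oneG cont_repM HB k l.
have eta0 : (0 : R) < (8 * m.+1%:R)^-1 by rewrite invr_gt0 mulr_gt0 // ltr0n.
have [b [p [d [h1 h2 h3 h4 h5]]]] := cont_rep_bump eta0.
have [N] := bump_unitmx GG capi HB (ap_hat_real h1) h2 h3 h4 h5.
set T := \matrix_(k, l) _ => Tu.
have hN x : hat (b ^+ N) x = (p x ^+ N)%:C by rewrite (hatX H) h1 rmorphXn.
have [l Hl] := hat_coproduct H (b ^+ N).
have capb a k q : cap (fun x => hat a x * pi x k q) by apply: (capM GG) => //; exact: cap_hat.
have piT g k q : (pi g *m T) k q =
    hat (\sum_(t <- l) cmean (fun x => hat t.2 x * pi x k q) *: t.1) g.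
  pose F x := hat (b ^+ N) (mulG (invG g) x) * pi x k q.
  have FE : F =1 fun x => \sum_(t <- l) hat t.1 g * (hat t.2 x * pi x k q).
    by move=> x; rewrite /F Hl mulr_suml; apply: eq_bigr => t _; rewrite mulrA.
  have capF : cap F.
    apply: cap_ext (fun x => esym (FE x)); apply: cap_sum => t.
    by apply: (capM GG) => //; exact: cap_cst.
  have -> : (pi g *m T) k q = cmean F.
    (* Invariance under [x |-> g x] turns the mean of [p^N (g^-1 x) pi x] into that of [p^N x] times
       [pi g *m pi x]. *)
    rewrite -(cmean_translate GG g capF) mxE.
    rewrite (@cmean_ext _ _ _ _ (fun x => \sum_r pi g k r * (hat (b ^+ N) x * pi x r q))).
      rewrite (cmean_sum GG) => [|r]; last by apply: (capM GG) => //; exact: cap_cst.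
      apply: eq_bigr => r _; rewrite mxE (cmeanZ GG) //; congr (_ * _).
      by apply: cmean_ext => x; rewrite hN.
    move=> x; rewrite /F (grp_mulA GG) (grp_mulV GG) (grp_mul1 GG) cont_repM mxE mulr_sumr.
    by apply: eq_bigr => r _; rewrite mulrCA.
  rewrite (cmean_ext mulG FE) (cmean_sum GG) => [|t]; last by apply: (capM GG) => //; exact: cap_cst.
  by rewrite (hat_sum H); apply: eq_bigr => t _; rewrite (cmeanZ GG) // (hatZ H) mulrC.
exists (\sum_q invmx T q j *: \sum_(t <- l) cmean (fun x => hat t.2 x * pi x i q) *: t.1).
apply/funext => g; rewrite (hat_sum H) -[pi g](mulmxK Tu) mxE.
by apply: eq_bigr => q _; rewrite piT (hatZ H) mulrC.
Qed.

End Representation.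

Lemma PolGtP (f : K -> C) : PolGt f <-> exists a, f = hat a.
Proof.
split=> [[N [ms [pis [cs [cont ->]]]]]|[a ->]]; last exact: (PolGt_hat H).
have /choice[a Ha] (k : 'I_N) : exists a, forall x, epair (cs k) (pis k x) = hat a x.
  have /choice[c Hc] (t : 'I_(ms k) * 'I_(ms k)) : exists a, (fun x => pis k x t.1 t.2) = hat a.
    exact: cont_rep_hat.
  exists (\sum_i \sum_j cs k i j *: c (i, j)) => x.
  rewrite /epair (hat_sum H); apply: eq_bigr => i _; rewrite (hat_sum H).
  by apply: eq_bigr => j _; rewrite (hatZ H) -(Hc (i, j)).
by exists (\sum_k a k); apply/funext => x; rewrite (hat_sum H); apply: eq_bigr => k _.
Qed.

End Surjectivity.

(** * The isomorphism of the two spectra *)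

Unset Implicit Arguments. Set Strict Implicit. Set Printing Implicit Defensive.

Theorem theorem4p5 (R : realType) (A : algType R[i]) (Irr : eqType)
    (n : Irr -> nat) (u : forall s, 'M[A]_(n s)) (star : A -> A) :
  cqg_algebra u star ->
  exists (Phi : (A -> R[i]) -> ((Gtilde u -> R[i]) -> R[i]))
         (Psi : ((Gtilde u -> R[i]) -> R[i]) -> (A -> R[i])),
    (forall phi, SpecPol A phi -> SpecPolGt u (Phi phi)) /\
    (forall chi, SpecPolGt u chi -> SpecPol A (Psi chi)) /\
    (forall phi, SpecPol A phi -> Psi (Phi phi) = phi) /\
    (forall chi, SpecPolGt u chi -> Phi (Psi chi) = chi) /\
    (forall phi psi chi, SpecPol A phi -> SpecPol A psi -> SpecPol A chi ->
          is_conv u phi psi chi -> is_convGt u (Phi phi) (Phi psi) (Phi chi)) /\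
    ptws_cont_on (SpecPol A) Phi /\ ptws_cont_on (SpecPolGt u) Psi.
Proof.
move=> H.
(* [pre] chooses a preimage under the Gelfand transform, with a dummy value off [PolGt]. Characters
   of [A] do not see the choice, by density of [Gtilde] ([char_eq]). *)
have /choice[pre Hpre] (f : Gtilde u -> R[i]) : exists a, PolGt f -> f = hat a.
  have [/(PolGtP H)[a ->]|nf] := pselect (PolGt f); first by exists a.
  by exists 0.
pose Phi (phi : A -> R[i]) (f : Gtilde u -> R[i]) : R[i] :=
  if `[< PolGt f >] then phi (pre f) else 0.
pose Psi (chi : (Gtilde u -> R[i]) -> R[i]) (a : A) := chi (hat a).
have PolH a : PolGt (hat (u := u) a) := PolGt_hat H a.
have PhiH phi a : is_char phi -> Phi phi (hat a) = phi a.
  move=> cp; rewrite /Phi; case: asboolP => // _.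
  by apply: (char_eq H) => // x; rewrite -Hpre.
have PhiN phi f : ~ PolGt f -> Phi phi f = 0 by rewrite /Phi; case: asboolP.
have hlin c a b : (fun x : Gtilde u => c * hat a x + hat b x) = hat (c *: a + b).
  by apply/funext => x; rewrite (hat_lin H).
have hmul a b : (fun x : Gtilde u => hat a x * hat b x) = hat (a * b).
  by apply/funext => x; rewrite (hatM H).
exists Phi, Psi; refine (conj _ (conj _ (conj _ (conj _ (conj _ (conj _ _)))))).
- move=> phi cp; have [lin mlt [a pa]] := cp; split.
  + by move=> c f g /(PolGtP H)[a1 ->] /(PolGtP H)[b1 ->]; rewrite hlin !PhiH.
  + by move=> f g /(PolGtP H)[a1 ->] /(PolGtP H)[b1 ->]; rewrite hmul !PhiH.
  + by exists (hat a); rewrite PhiH.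
  + by move=> f; apply: PhiN.
- move=> chi [lin mlt [f [/(PolGtP H)[a ->] ca]] _]; split.
  + by move=> c b1 b2; rewrite /Psi -hlin lin.
  + by move=> b1 b2; rewrite /Psi -hmul mlt.
  + by exists a.
- by move=> phi cp; apply/funext => a; rewrite /Psi PhiH.
- move=> chi cc; apply/funext => f; have [_ _ _ c0] := cc.
  have [Pf|nf] := pselect (PolGt f); last by rewrite PhiN // c0.
  by rewrite /Phi; case: asboolP => // _; rewrite /Psi -Hpre.
(* On [Gtilde] the entries of [pi] multiply as matrices. Density carries this identity to [phi] and
   [psi] one variable at a time: first [psi] is replaced by points [y], then [phi] by points [x]. *)
- move=> phi psi chi cp cs cc conv m pi cpi i j.
  have /choice[c Hc] (t : 'I_m * 'I_m) := cont_rep_hat H cpi t.1 t.2.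
  rewrite (Hc (i, j)) PhiH //.
  under eq_bigr => k _ do rewrite (Hc (i, k)) (Hc (k, j)) !PhiH //.
  have mulE x y : hat (c (i, j)) (mulG H x y) = \sum_k hat (c (i, k)) x * hat (c (k, j)) y.
    rewrite -Hc /= (cont_repM H cpi) mxE; apply: eq_bigr => k _.
    by rewrite -!Hc.
  have [b Hb] := left_translate H (Xphi u phi) (c (i, j)).
  have [phiE _] := is_char_chr H cp; have [psiE _] := is_char_chr H cs.
  have [chiE _] := is_char_chr H cc.
  have -> : chi (c (i, j)) = psi b.
    rewrite chiE psiE Hb; apply: eq_fn => s; apply/matrixP => k l.
    by rewrite !mxE conv; apply: eq_bigr => r _; rewrite !mxE.
  have -> : \sum_k phi (c (i, k)) * psi (c (k, j)) = psi (\sum_k phi (c (i, k)) *: c (k, j)).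
    by rewrite psiE linear_sum; apply: eq_bigr => k _; rewrite linearZ.
  apply: (char_eq H) => // y.
  have -> : hat b y = phi (Lop H (Xphi u (sval y)) (c (i, j))).
    by rewrite /hat (GE H) Hb phiE fn_Lop -phiE.
  have -> : hat (\sum_k phi (c (i, k)) *: c (k, j)) y =
      phi (\sum_k hat (c (k, j)) y *: c (i, k)).
    rewrite (hat_sum H) phiE linear_sum; apply: eq_bigr => k _.
    by rewrite (hatZ H) linearZ /= -phiE mulrC.
  apply: (char_eq H) => // x.
  have -> : hat (Lop H (Xphi u (sval y)) (c (i, j))) x = hat (c (i, j)) (mulG H x y).
    by rewrite /hat (GE H) fn_Lop.
  by rewrite mulE (hat_sum H); apply: eq_bigr => k _; rewrite (hatZ H) mulrC.
(* Each coordinate of [Phi phi] is [0] or the value of [phi] at the fixed element [pre (es k)], so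
   [delta = eps] works; likewise for [Psi] with [hat (es k)]. *)
- move=> phi0 _ N es eps e0; exists N, (fun k => pre (es k)), eps; split=> // phi _ near k.
  by rewrite /Phi; case: asboolP => // _; rewrite subrr normr0 ltcR.
- by move=> chi0 _ N es eps e0; exists N, (fun k => hat (es k)), eps; split.
Qed.
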